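(* For the problems (P0-RNN) and (P1-RNN) described in the context: (i) The sets of global minimizers $\mathcal{S}_0^{RNN}$ and $\mathcal{S}_1^{RNN}$ are nonempty and compact for all $\beta_1,\beta_2>0$. (ii) Any local minimizer $z$ of (P0-RNN) is a second-order d-stationary point of (P0-RNN), that is, $z\in\mathcal{F}_0^{RNN}$, $[\nabla F(z)]^\top d\ge0$ for all $d\in\mathcal{T}_{\mathcal{F}_0^{RNN}}(z)$, and $d^\top\nabla^2F(z)d\ge0$ for all $d\in P_{\mathcal{F}_0^{RNN}}(z)$ with $[\nabla F(z)]^\top d=0$. For all $\beta_1,\beta_2>0$, any local minimizer $z$ of (P1-RNN) is a second-order d-stationary point of (P1-RNN), that is, $\Theta'(z;d)\ge0$ for all $d\in\mathbb{R}^{\bar N}$ and $\Theta^{(2)}(z;d)\ge0$ for all $d$ with $\Theta'(z;d)=0$. Here, for any $z\in\mathcal{F}_0^{RNN}$, $$\mathcal{T}_{\mathcal{F}_0^{RNN}}(z)=\left\{d\in\mathbb{R}^{\bar N}\ \middle|\ \begin{array}{l}d_{v_t}=D_Vs_t+Vd_{s_t}+d_c,\quad d_{r_t}=\sigma'(v_t;d_{v_t}),\\ d_{w_t}=D_Ws_{t-1}+Wd_{s_{t-1}}+D_Ax_t+d_b,\quad d_{s_t}=\sigma'(w_t;d_{w_t}),\ t\in\{1,2,3\}\end{array}\right\},$$ $$P_{\mathcal{F}_0^{RNN}}(z)=\{d\in\mathcal{T}_{\mathcal{F}_0^{RNN}}(z)\mid D_Vd_{s_t}=0,\ D_Wd_{s_{t-1}}=0,\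 t\in\{1,2,3\}\}.$$ (iii) Let $\gamma_y:=\Theta(\mathbf{0})=\|y\|^2/6$ and $\gamma_1:=\sum_{i=0}^{2}(\sqrt{\gamma_y/\lambda})^i$. If $$\beta_1>\gamma_1\gamma_y\sqrt{2/(3\lambda)},\qquad\beta_2>\sqrt{2\gamma_y/3},$$ then (a) $\mathcal{S}_0^{RNN}=\mathcal{S}_1^{RNN}$; and (b) for any $z$ with $\Theta(z)\le\gamma_y$, $z$ is a d-stationary point of (P0-RNN) if and only if it is a d-stationary point of (P1-RNN).
   Context: Let $N_0,N_1,N_2$ be positive integers, $\lambda>0$, inputs $x_t\in\mathbb{R}^{N_0}$ and labels $y_t\in\mathbb{R}^{N_2}$ for $t\in\{1,2,3\}$, $y=(y_1,y_2,y_3)\in\mathbb{R}^{3N_2}$. Let $\alpha\in[0,1)$ and $\sigma(a)=\max\{a,\alpha a\}$ for $a\in\mathbb{R}$, applied componentwise to vectors. Variables: $A\in\mathbb{R}^{N_1\times N_0}$, $V\in\mathbb{R}^{N_2\times N_1}$, $W\in\mathbb{R}^{N_1\times N_1}$, $b\in\mathbb{R}^{N_1}$, $c\in\mathbb{R}^{N_2}$, collected (with matrices vectorized columnwise) into $\theta=(\operatorname{vec}(A),\operatorname{vec}(V),\operatorname{vec}(W),b,c)\in\mathbb{R}^n$, $n=N_0N_1+N_1N_2+N_1^2+N_1+N_2$; and $w_t,s_t\in\mathbb{R}^{N_1}$, $v_t,r_t\in\mathbb{R}^{N_2}$ for $t\in\{1,2,3\}$, with $v=(v_1,v_2,v_3)$,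 $r=(r_1,r_2,r_3)$, $u=(w_1,s_1,w_2,s_2,w_3,s_3,v,r)$. The constant $s_0=\mathbf{0}\in\mathbb{R}^{N_1}$ is fixed. Put $z=(\theta,u)\in\mathbb{R}^{\bar N}$, $\bar N=n+6(N_1+N_2)$. $\|\cdot\|$ is the Euclidean norm. $F(z)=\frac{\|r-y\|^2}{6}+\lambda\|\theta\|^2$ (note $\|\theta\|^2=\|A\|_F^2+\|V\|_F^2+\|W\|_F^2+\|b\|^2+\|c\|^2$). $\mathcal{F}_0^{RNN}=\{z\mid w_t=Ws_{t-1}+Ax_t+b,\ s_t=\sigma(w_t),\ v_t=Vs_t+c,\ r_t=\sigma(v_t),\ t\in\{1,2,3\}\}$. (P0-RNN): $\min_{z\in\mathcal{F}_0^{RNN}}F(z)$, with set of global minimizers $\mathcal{S}_0^{RNN}$. (P1-RNN), for $\beta_1,\beta_2>0$: $\min_{z\in\mathbb{R}^{\bar N}}\Theta(z)$, with set of global minimizers $\mathcal{S}_1^{RNN}$, where $\Theta(z)=F(z)+\beta_1\sum_{t=1}^{3}(\|w_t-Ws_{t-1}-Ax_t-b\|_1+\|s_t-\sigma(w_t)\|_1)+\beta_2\sum_{t=1}^{3}(\|v_t-Vs_t-c\|_1+\|r_t-\sigma(v_t)\|_1)$. Directions $d\in\mathbb{R}^{\bar N}$ are split conformably with $z$: components $d_A,d_V,d_W,d_b,d_c$ and $d_{w_t},d_{s_t},d_{v_t},d_{r_t}$, with the convention $d_{s_0}=\mathbf{0}$; $D_A\in\mathbb{R}^{N_1\times N_0}$,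 $D_V\in\mathbb{R}^{N_2\times N_1}$, $D_W\in\mathbb{R}^{N_1\times N_1}$ are the matrices with $\operatorname{vec}(D_A)=d_A$, $\operatorname{vec}(D_V)=d_V$, $\operatorname{vec}(D_W)=d_W$. Directional derivative: $f'(x;d)=\lim_{\tau\downarrow0}\frac{f(x+\tau d)-f(x)}{\tau}$; second-order: $f^{(2)}(x;d)=\lim_{\tau\downarrow0}\frac{f(x+\tau d)-f(x)-\tau f'(x;d)}{\tau^2/2}$ (componentwise for vector-valued $f$). Tangent cone: $\mathcal{T}_{\mathcal{F}}(x)=\{d\mid\exists\,x^k\to x,\ x^k\in\mathcal{F},\ \tau_k\downarrow0\text{ with }(x^k-x)/\tau_k\to d\}$. Radial cone: $P_{\mathcal{F}}(x)=\{d\mid\exists\,\tau_k\downarrow0\text{ such that }x+\tau_kd\in\mathcal{F}\text{ for all }k\}$. $z$ is a d-stationary point of (P0-RNN) if $z\in\mathcal{F}_0^{RNN}$ and $F'(z;d)\ge0$ for all $d\in\mathcal{T}_{\mathcal{F}_0^{RNN}}(z)$; $z$ is a d-stationary point of (P1-RNN) if $\Theta'(z;d)\ge0$ for all $d\in\mathbb{R}^{\bar N}$. *)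

(* Defs.v *)
From HB Require Import structures.
From mathcomp Require Import all_boot all_order all_algebra.
From mathcomp Require Import all_classical all_reals all_analysis.
From mathcomp Require Import zify.

Set Implicit Arguments.
Unset Strict Implicit.
Unset Printing Implicit Defensive.

Import Order.TTheory GRing.Theory Num.Theory.
Import numFieldNormedType.Exports.

Local Open Scope classical_set_scope.
Local Open Scope ring_scope.

(* The norm `|_| that the library puts on matrices is the sup norm, which has
   the Euclidean topology but not the Euclidean values: hence enorm. *)
Definition enorm (R : realType) (m n : nat) (M : 'M[R]_(m, n)) : R :=
  Num.sqrt (\sum_i \sum_j M i j ^+ 2).

Definition l1norm (R : realType) (m n : nat) (M : 'M[R]_(m, n)) : R :=
  \sum_i \sum_j `|M i j|.

Definition dotp (R : realType) (n : nat) (u v : 'rV[R]_n) : R :=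
  (u *m v^T) 0 0.

Definition gradient (R : realType) (n : nat) (f : 'rV[R]_n -> R)
    (x : 'rV[R]_n) : 'rV[R]_n :=
  \row_i 'D_(delta_mx 0 i) f x.

Definition hessian (R : realType) (n : nat) (f : 'rV[R]_n -> R)
    (x : 'rV[R]_n) : 'M[R]_n :=
  \matrix_(i, j) 'D_(delta_mx 0 i) (fun x' => 'D_(delta_mx 0 j) f x') x.

Section OneSidedDerivatives.
Context {R : realType} {U V : normedModType R}.
Implicit Types (f : U -> V) (x d : U).

Definition dquot f x d (tau : R) : V := tau^-1 *: (f (x + tau *: d) - f x).

Definition ddifferentiable f x d : Prop := cvg (dquot f x d tau @[tau --> 0^'+]).

(* 'D_d f x is the two-sided limit, hence not suited to nonsmooth f. *)
Definition dderiv f x d : V := lim (dquot f x d tau @[tau --> 0^'+]).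

Definition dquot2 f x d (tau : R) : V :=
  (tau ^+ 2 / 2)^-1 *: (f (x + tau *: d) - f x - tau *: dderiv f x d).

Definition ddifferentiable2 f x d : Prop :=
  cvg (dquot2 f x d tau @[tau --> 0^'+]).

Definition dderiv2 f x d : V := lim (dquot2 f x d tau @[tau --> 0^'+]).

End OneSidedDerivatives.

Section Optimization.
Context {R : realType} {U : normedModType R}.
Implicit Types (D : set U) (f : U -> R) (x d : U).

Definition tangent_cone D x : set U :=
  [set d | exists (xk : nat -> U) (tau : nat -> R),
     [/\ forall k, D (xk k),
         xk k @[k --> \oo] --> x,
         forall k, 0 < tau k,
         tau k @[k --> \oo] --> (0 : R)
       & (tau k)^-1 *: (xk k - x) @[k --> \oo] --> d]].

Definition radial_cone D x : set U :=
  [set d | exists tau : nat -> R,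
     [/\ forall k, 0 < tau k,
         tau k @[k --> \oo] --> (0 : R)
       & forall k, D (x + tau k *: d)]].

Definition global_minimizers D f : set U :=
  [set x | D x /\ forall x', D x' -> f x <= f x'].

Definition local_minimizer D f x : Prop :=
  D x /\ \forall x' \near x, D x' -> f x <= f x'.

(* lim is total, so the existence of the limit is asserted with its sign. *)
Definition d_stationary D f x : Prop :=
  D x /\ forall d, tangent_cone D x d ->
    ddifferentiable f x d /\ 0 <= dderiv f x d.

Definition d_stationary_free f x : Prop :=
  forall d, ddifferentiable f x d /\ 0 <= dderiv f x d.

Definition second_order_d_stationary_free f x : Prop :=
  d_stationary_free f x /\
  forall d, dderiv f x d = 0 -> ddifferentiable2 f x d /\ 0 <= dderiv2 f x d.

End Optimization.

Definition second_order_d_stationary (R : realType) (n : nat)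
    (D : set 'rV[R]_n) (f : 'rV[R]_n -> R) (x : 'rV[R]_n) : Prop :=
  [/\ D x,
      forall d, tangent_cone D x d -> 0 <= dotp (gradient f x) d
    & forall d, radial_cone D x d -> dotp (gradient f x) d = 0 ->
        0 <= dotp (d *m hessian f x) d].

(* A point z = (theta, u) is a row vector, with
     theta = (vec A, vec V, vec W, b, c),
     u = ((w_1, s_1, w_2, s_2, w_3, s_3), (v, r)).
   The time t = 1, 2, 3 is represented by the ordinals 0, 1, 2. *)
Definition ntheta (N0 N1 N2 : nat) : nat :=
  (N0 * N1 + (N1 * N2 + (N1 * N1 + (N1 + N2))))%N.

Definition nu (N1 N2 : nat) : nat :=
  (3 * (N1 + N1) + (3 * N2 + 3 * N2))%N.

Definition nz (N0 N1 N2 : nat) : nat :=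
  (ntheta N0 N1 N2 + nu N1 N2)%N.

Fact nzE (N0 N1 N2 : nat) :
  nz N0 N1 N2 = (N0 * N1 + N1 * N2 + N1 ^ 2 + N1 + N2 + 6 * (N1 + N2))%N.
Proof. by rewrite /nz /ntheta /nu; lia. Qed.

(* vec_mx reads a row vector row by row; the transpose of the result is the
   matrix whose columnwise vectorization is the given vector. *)
Definition unvec (R : realType) (m n : nat) (a : 'rV[R]_(n * m)) : 'M[R]_(m, n) :=
  (vec_mx a)^T.

Section Blocks.
Context {R : realType} {N0 N1 N2 : nat}.
Implicit Types (z : 'rV[R]_(nz N0 N1 N2)) (t : 'I_3).

Definition z_theta z : 'rV[R]_(ntheta N0 N1 N2) := lsubmx z.
Definition z_u z : 'rV[R]_(nu N1 N2) := rsubmx z.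

Definition z_A z : 'M[R]_(N1, N0) := unvec (lsubmx (z_theta z)).
Definition z_V z : 'M[R]_(N2, N1) := unvec (lsubmx (rsubmx (z_theta z))).
Definition z_W z : 'M[R]_(N1, N1) :=
  unvec (lsubmx (rsubmx (rsubmx (z_theta z)))).
Definition z_b z : 'cV[R]_N1 :=
  (lsubmx (rsubmx (rsubmx (rsubmx (z_theta z)))))^T.
Definition z_c z : 'cV[R]_N2 :=
  (rsubmx (rsubmx (rsubmx (rsubmx (z_theta z)))))^T.

Definition z_ws z : 'rV[R]_(3 * (N1 + N1)) := lsubmx (z_u z).
Definition z_vvec z : 'rV[R]_(3 * N2) := lsubmx (rsubmx (z_u z)).
Definition z_rvec z : 'rV[R]_(3 * N2) := rsubmx (rsubmx (z_u z)).

Definition z_w z t : 'cV[R]_N1 := (lsubmx (row t (vec_mx (z_ws z))))^T.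
Definition z_s z t : 'cV[R]_N1 := (rsubmx (row t (vec_mx (z_ws z))))^T.
Definition z_v z t : 'cV[R]_N2 := (row t (vec_mx (z_vvec z)))^T.
Definition z_r z t : 'cV[R]_N2 := (row t (vec_mx (z_rvec z)))^T.

(* s_(t-1), with s_0 = 0 *)
Definition z_sprev z t : 'cV[R]_N1 :=
  if (t : nat) is k.+1 then z_s z (inord k) else 0.

End Blocks.

Section RNN.
Context {R : realType} {N0 N1 N2 : nat}.
Variables (lambda alpha : R) (x : 'I_3 -> 'cV[R]_N0) (y : 'I_3 -> 'cV[R]_N2).
Implicit Types (z d : 'rV[R]_(nz N0 N1 N2)).

Definition sigma (n : nat) (a : 'cV[R]_n) : 'cV[R]_n :=
  map_mx (fun e => Num.max e (alpha * e)) a.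

Definition yvec : 'rV[R]_(3 * N2) := mxvec (\matrix_(t, i) y t i 0).

Definition F z : R :=
  enorm (z_rvec z - yvec) ^+ 2 / 6 + lambda * enorm (z_theta z) ^+ 2.

Definition F0RNN : set 'rV[R]_(nz N0 N1 N2) :=
  [set z | forall t,
     [/\ z_w z t = z_W z *m z_sprev z t + z_A z *m x t + z_b z,
         z_s z t = sigma (z_w z t),
         z_v z t = z_V z *m z_s z t + z_c z
       & z_r z t = sigma (z_v z t)]].

Definition Theta (beta1 beta2 : R) z : R :=
  F z
  + beta1 * (\sum_t
      (l1norm (z_w z t - z_W z *m z_sprev z t - z_A z *m x t - z_b z)
       + l1norm (z_s z t - sigma (z_w z t))))
  + beta2 * (\sum_t
      (l1norm (z_v z t - z_V z *m z_s z t - z_c z)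
       + l1norm (z_r z t - sigma (z_v z t)))).

Definition S0RNN : set 'rV[R]_(nz N0 N1 N2) := global_minimizers F0RNN F.

Definition S1RNN (beta1 beta2 : R) : set 'rV[R]_(nz N0 N1 N2) :=
  global_minimizers setT (Theta beta1 beta2).

Definition tangent_formula z : set 'rV[R]_(nz N0 N1 N2) :=
  [set d | forall t,
     [/\ z_v d t = z_V d *m z_s z t + z_V z *m z_s d t + z_c d,
         z_r d t = dderiv (@sigma N2) (z_v z t) (z_v d t),
         z_w d t = z_W d *m z_sprev z t + z_W z *m z_sprev d t
                   + z_A d *m x t + z_b d
       & z_s d t = dderiv (@sigma N1) (z_w z t) (z_w d t)]].

Definition gamma_y : R := enorm yvec ^+ 2 / 6.

Definition gamma_1 : R := \sum_(i < 3) Num.sqrt (gamma_y / lambda) ^+ i.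

End RNN.

(* Main.v *)
Require Import Defs.
From mathcomp Require Import all_boot all_order all_algebra.
From mathcomp Require Import all_classical all_reals all_analysis.
From mathcomp Require Import ring lra.
Import Order.TTheory GRing.Theory Num.Theory.
Import numFieldNormedType.Exports.
Local Open Scope classical_set_scope.
Local Open Scope ring_scope.

Set Implicit Arguments.
Unset Strict Implicit.
Unset Printing Implicit Defensive.

(** Every term of the penalised objective is, along a ray [z + tau *: d] and for
small [tau > 0], a polynomial of degree two in [tau]: the residuals of the
network equations are polynomials there because the activation is piecewise
linear, and as a polynomial keeps a constant sign just to the right of zero, its
absolute value is there again a polynomial ([Theta_ray2]).  The one-sided derivatives of both orders
therefore exist and can be read off from the coefficients, and the optimality
conditions of the second assertion are statements on the signs of these
coefficients.  For the constrained problem [F] is a quadratic polynomial with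
nonnegative quadratic part, so only the first-order condition has content.

The network equations are a recursion in time: a point with given parameters
and small residuals can be changed into one with vanishing residuals by solving
the recursion, and since the activation and its one-sided derivative are
nonexpansive the change is controlled by the residuals ([perturbed_recursion]).
Behind this is a scalar recursion ([recursion_bound]), whose amplification
factor over the three time steps is [1 + rho + rho ^+ 2] when [rho] bounds the
parameters.  It is used in three ways.

- Applied to the network it is an error bound for the feasible set
  ([feasible_error_bound]).  A direction that solves the linearised equations
  leaves residuals of order [tau ^+ 2], so that correcting [z + tau *: d] yields
  feasible points with secants tending to [d]: the tangent cone is given by the
  linearised equations ([tangent_coneE]).
- Compared with the zero state it bounds the states of a point by its
  parameters and residuals, so that sublevel sets of [Theta] are bounded, hence
  compact ([Theta_sublevel_bounded]).
- Applied to the linearised network it turns any direction into one that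
  cancels all residuals to first order and has the same parameters; the data
  term increases by less than the penalties gain when [beta1] and [beta2] exceed
  their thresholds ([dF_correction]).  Starting from the zero direction it gives
  a direction of descent at infeasible points ([stationary_feasible]); starting
  from an arbitrary direction at a feasible point it compares the derivative of
  [Theta] with that of [F] along a tangent direction ([stationary_equiv]).

Equality of the sets of minimizers follows: global minimizers of [Theta] lie in
the sublevel set of the origin and are stationary, hence feasible, and [Theta]
agrees with [F] on the feasible set. *)

(** * The Euclidean norm of matrices *)

Section EuclideanNorm.
Context {R : realType}.

Definition mxdot (m n : nat) (A B : 'M[R]_(m, n)) : R :=
  \sum_i \sum_j A i j * B i j.

Lemma mxdotC m n (A B : 'M[R]_(m, n)) : mxdot A B = mxdot B A.
Proof. by apply: eq_bigr => i _; apply: eq_bigr => j _; rewrite mulrC. Qed.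

Lemma mxdotP m n (a : R) (A B C : 'M[R]_(m, n)) :
  mxdot (a *: A + B) C = a * mxdot A C + mxdot B C.
Proof.
rewrite /mxdot mulr_sumr -big_split; apply: eq_bigr => i _ /=.
rewrite mulr_sumr -big_split; apply: eq_bigr => j _ /=.
by rewrite !mxE mulrDl mulrA.
Qed.

Lemma mxdotDl m n (A B C : 'M[R]_(m, n)) :
  mxdot (A + B) C = mxdot A C + mxdot B C.
Proof. by rewrite -[A]scale1r mxdotP mul1r scale1r. Qed.

Lemma mxdot0l m n (C : 'M[R]_(m, n)) : mxdot 0 C = 0.
Proof. by apply: big1 => i _; apply: big1 => j _; rewrite mxE mul0r. Qed.

Lemma mxdotZl m n a (A C : 'M[R]_(m, n)) : mxdot (a *: A) C = a * mxdot A C.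
Proof. by rewrite -[a *: A]addr0 mxdotP mxdot0l addr0. Qed.

Lemma mxdotDr m n (A B C : 'M[R]_(m, n)) :
  mxdot C (A + B) = mxdot C A + mxdot C B.
Proof. by rewrite mxdotC mxdotDl !(mxdotC C). Qed.

Lemma mxdotZr m n a (A C : 'M[R]_(m, n)) : mxdot C (a *: A) = a * mxdot C A.
Proof. by rewrite mxdotC mxdotZl (mxdotC C). Qed.

Lemma mxdot_ge0 m n (A : 'M[R]_(m, n)) : 0 <= mxdot A A.
Proof. by apply: sumr_ge0 => i _; apply: sumr_ge0 => j _; rewrite -expr2 sqr_ge0. Qed.

Lemma enorm_sqr m n (A : 'M[R]_(m, n)) : enorm A ^+ 2 = mxdot A A.
Proof.
have -> : mxdot A A = \sum_i \sum_j A i j ^+ 2 by [].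
by rewrite sqr_sqrtr //; exact: mxdot_ge0.
Qed.

Lemma enorm_ge0 m n (A : 'M[R]_(m, n)) : 0 <= enorm A.
Proof. exact: sqrtr_ge0. Qed.
#[local] Hint Resolve enorm_ge0 : core.

Lemma entry_le_enorm m n (A : 'M[R]_(m, n)) i j : `|A i j| <= enorm A.
Proof.
rewrite -(@ler_pXn2r _ 2) ?nnegrE // enorm_sqr real_normK ?num_real //.
rewrite /mxdot (bigD1 i) //= (bigD1 j) //= -expr2 -addrA lerDl.
apply: addr_ge0; first by apply: sumr_ge0 => k _; rewrite -expr2 sqr_ge0.
by apply: sumr_ge0 => k _; apply: sumr_ge0 => l _; rewrite -expr2 sqr_ge0.
Qed.

Lemma enorm0 m n : enorm (0 : 'M[R]_(m, n)) = 0.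
Proof.
by apply/eqP; rewrite -sqrf_eq0 enorm_sqr mxdot0l.
Qed.

Lemma enorm_eq0 m n (A : 'M[R]_(m, n)) : enorm A = 0 -> A = 0.
Proof.
move=> A0; apply/matrixP => i j; rewrite mxE; apply/eqP.
by rewrite -normr_le0 -A0 entry_le_enorm.
Qed.

(** Cauchy-Schwarz, from the nonnegativity of the squared norm of
[enorm B *: A - enorm A *: B]. *)
Lemma mxdot_le m n (A B : 'M[R]_(m, n)) : mxdot A B <= enorm A * enorm B.
Proof.
have [a0|a0] := eqVneq (enorm A) 0.
  by rewrite (enorm_eq0 a0) mxdot0l enorm0 mul0r.
have [b0|b0] := eqVneq (enorm B) 0.
  by rewrite (enorm_eq0 b0) mxdotC mxdot0l enorm0 mulr0.
have ab : 0 < enorm A * enorm B by rewrite mulr_gt0 ?lt0r ?a0 ?b0 ?enorm_ge0.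
have := mxdot_ge0 (enorm B *: A + (- enorm A) *: B).
rewrite !(mxdotDl, mxdotDr, mxdotZl, mxdotZr) (mxdotC B A) -!enorm_sqr => h.
rewrite -subr_ge0 -(pmulr_rge0 _ ab); nra.
Qed.

Lemma mxdot_abs_le m n (A B : 'M[R]_(m, n)) : `|mxdot A B| <= enorm A * enorm B.
Proof.
have /orP[h|h] := le_total 0 (mxdot A B).
  by rewrite ger0_norm // mxdot_le.
rewrite ler0_norm // -mulN1r -mxdotZl.
apply: (le_trans (mxdot_le _ _)); rewrite ler_wpM2r //.
by rewrite -(@ler_pXn2r _ 2) ?nnegrE // !enorm_sqr mxdotZl mxdotZr mulN1r mulN1r opprK.
Qed.

Lemma enormD m n (A B : 'M[R]_(m, n)) : enorm (A + B) <= enorm A + enorm B.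
Proof.
rewrite -(@ler_pXn2r _ 2) ?nnegrE ?addr_ge0 // enorm_sqr.
rewrite !(mxdotDl, mxdotDr) (mxdotC B A) -!enorm_sqr.
have := mxdot_le A B; nra.
Qed.

Lemma enormZ m n a (A : 'M[R]_(m, n)) : enorm (a *: A) = `|a| * enorm A.
Proof.
apply/eqP; rewrite -(@eqrXn2 _ 2) ?mulr_ge0 // exprMn !enorm_sqr.
by rewrite mxdotZl mxdotZr real_normK ?num_real // mulrA -expr2.
Qed.

Lemma enormN m n (A : 'M[R]_(m, n)) : enorm (- A) = enorm A.
Proof. by rewrite -scaleN1r enormZ normrN1 mul1r. Qed.

Lemma enorm_tr m n (A : 'M[R]_(m, n)) : enorm A^T = enorm A.
Proof.
apply/eqP; rewrite -(@eqrXn2 _ 2) // !enorm_sqr /mxdot exchange_big /=.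
by apply/eqP; apply: eq_bigr => i _; apply: eq_bigr => j _; rewrite !mxE.
Qed.

Lemma sqr_enorm_rows m n (A : 'M[R]_(m, n)) :
  enorm A ^+ 2 = \sum_i enorm (row i A) ^+ 2.
Proof.
rewrite enorm_sqr; apply: eq_bigr => i _.
by rewrite enorm_sqr /mxdot big_ord1; apply: eq_bigr => j _; rewrite !mxE.
Qed.

Lemma sqr_enorm_row_mx m n1 n2 (A : 'M[R]_(m, n1)) (B : 'M[R]_(m, n2)) :
  enorm (row_mx A B) ^+ 2 = enorm A ^+ 2 + enorm B ^+ 2.
Proof.
rewrite !enorm_sqr /mxdot -big_split /=; apply: eq_bigr => i _.
by rewrite big_split_ord /=; congr (_ + _); apply: eq_bigr => j _;
  rewrite ?row_mxEl ?row_mxEr.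
Qed.

Lemma sqr_enorm_split n1 n2 (A : 'rV[R]_(n1 + n2)) :
  enorm A ^+ 2 = enorm (lsubmx A) ^+ 2 + enorm (rsubmx A) ^+ 2.
Proof. by rewrite -sqr_enorm_row_mx hsubmxK. Qed.

Lemma enorm_vec_mx m n (v : 'rV[R]_(m * n)) : enorm (vec_mx v) = enorm v.
Proof.
apply/eqP; rewrite -(@eqrXn2 _ 2) // !enorm_sqr /mxdot big_ord1.
rewrite pair_bigA /= (reindex _ (curry_mxvec_bij _ _)) /=.
by apply/eqP; apply: eq_bigr => -[i j] _; rewrite !mxE.
Qed.

(** The entries of [A *m B] are the products of a row of [A] with a column of
[B], to which Cauchy-Schwarz applies. *)
Lemma enormM m n p (A : 'M[R]_(m, n)) (B : 'M[R]_(n, p)) :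
  enorm (A *m B) <= enorm A * enorm B.
Proof.
rewrite -(@ler_pXn2r _ 2) ?nnegrE ?mulr_ge0 // exprMn (sqr_enorm_rows A) enorm_sqr.
rewrite /mxdot mulr_suml; apply: ler_sum => i _.
rewrite -(enorm_tr B) (sqr_enorm_rows B^T) mulr_sumr; apply: ler_sum => j _.
rewrite -expr2 -exprMn -real_normK ?num_real // lerXn2r ?nnegrE ?mulr_ge0 //.
rewrite (_ : (A *m B) i j = mxdot (row i A) (row j B^T)) ?mxdot_abs_le //.
by rewrite mxE /mxdot big_ord1; apply: eq_bigr => k _; rewrite !mxE.
Qed.

Lemma l1norm_ge0 m n (A : 'M[R]_(m, n)) : 0 <= l1norm A.
Proof. by apply: sumr_ge0 => i _; apply: sumr_ge0. Qed.

Lemma entry_le_l1norm m n (A : 'M[R]_(m, n)) i j : `|A i j| <= l1norm A.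
Proof.
rewrite /l1norm (bigD1 i) //= (bigD1 j) //= -addrA lerDl.
by apply: addr_ge0; do ?[apply: sumr_ge0 => ? _].
Qed.

Lemma l1norm0 m n : l1norm (0 : 'M[R]_(m, n)) = 0.
Proof. by apply: big1 => i _; apply: big1 => j _; rewrite mxE normr0. Qed.

Lemma l1norm_eq0 m n (A : 'M[R]_(m, n)) : l1norm A = 0 -> A = 0.
Proof.
move=> A0; apply/matrixP => i j; rewrite mxE; apply/eqP.
by rewrite -normr_le0 -A0 entry_le_l1norm.
Qed.

Lemma enorm_le_l1norm m n (A : 'M[R]_(m, n)) : enorm A <= l1norm A.
Proof.
rewrite -(@ler_pXn2r _ 2) ?nnegrE ?l1norm_ge0 // enorm_sqr expr2.
rewrite {1}/l1norm mulr_suml; apply: ler_sum => i _.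
rewrite mulr_suml; apply: ler_sum => j _.
rewrite (le_trans (ler_norm _)) // normrM ler_wpM2l //.
exact: entry_le_l1norm.
Qed.

End EuclideanNorm.
#[global] Hint Extern 0 (is_true (0 <= enorm _)) => exact: enorm_ge0 : core.

(** * The blocks of a point *)

Lemma le_term_sum (R : numDomainType) (I : finType) (f : I -> R) i :
  (forall j, 0 <= f j) -> f i <= \sum_j f j.
Proof. by move=> f0; rewrite (bigD1 i) //= lerDl sumr_ge0. Qed.

Section Blocks.
Context {R : realType} {N0 N1 N2 : nat}.
Notation point := ('rV[R]_(nz N0 N1 N2)).
Implicit Types (z d : point) (a : R) (t : 'I_3).

Lemma z_thetaP z a d : z_theta (z + a *: d) = z_theta z + a *: z_theta d.
Proof. by apply/matrixP => i j; rewrite !mxE. Qed.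

Lemma z_AP z a d : z_A (z + a *: d) = z_A z + a *: z_A d.
Proof. by apply/matrixP => i j; rewrite !mxE. Qed.

Lemma z_VP z a d : z_V (z + a *: d) = z_V z + a *: z_V d.
Proof. by apply/matrixP => i j; rewrite !mxE. Qed.

Lemma z_WP z a d : z_W (z + a *: d) = z_W z + a *: z_W d.
Proof. by apply/matrixP => i j; rewrite !mxE. Qed.

Lemma z_bP z a d : z_b (z + a *: d) = z_b z + a *: z_b d.
Proof. by apply/matrixP => i j; rewrite !mxE. Qed.

Lemma z_cP z a d : z_c (z + a *: d) = z_c z + a *: z_c d.
Proof. by apply/matrixP => i j; rewrite !mxE. Qed.

Lemma z_wP z a d t : z_w (z + a *: d) t = z_w z t + a *: z_w d t.
Proof. by apply/matrixP => i j; rewrite !mxE. Qed.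

Lemma z_sP z a d t : z_s (z + a *: d) t = z_s z t + a *: z_s d t.
Proof. by apply/matrixP => i j; rewrite !mxE. Qed.

Lemma z_vP z a d t : z_v (z + a *: d) t = z_v z t + a *: z_v d t.
Proof. by apply/matrixP => i j; rewrite !mxE. Qed.

Lemma z_rP z a d t : z_r (z + a *: d) t = z_r z t + a *: z_r d t.
Proof. by apply/matrixP => i j; rewrite !mxE. Qed.

Lemma z_rvecP z a d : z_rvec (z + a *: d) = z_rvec z + a *: z_rvec d.
Proof. by apply/matrixP => i j; rewrite !mxE. Qed.

Lemma z_sprevP z a d t :
  z_sprev (z + a *: d) t = z_sprev z t + a *: z_sprev d t.
Proof.
rewrite /z_sprev; case: (t : nat) => [|k]; last exact: z_sP.
by rewrite scaler0 addr0.
Qed.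

Definition z_linE := (z_thetaP, z_AP, z_VP, z_WP, z_bP, z_cP, z_wP, z_sP, z_vP,
  z_rP, z_rvecP, z_sprevP).

Lemma sqr_enorm_theta z :
  enorm (z_theta z) ^+ 2 = enorm (z_A z) ^+ 2 + enorm (z_V z) ^+ 2 +
    enorm (z_W z) ^+ 2 + enorm (z_b z) ^+ 2 + enorm (z_c z) ^+ 2.
Proof.
rewrite /z_A /z_V /z_W /z_b /z_c /unvec !enorm_tr !enorm_vec_mx.
by rewrite -!addrA -!sqr_enorm_split.
Qed.

Lemma sqr_enorm_rvec z : enorm (z_rvec z) ^+ 2 = \sum_t enorm (z_r z t) ^+ 2.
Proof.
rewrite -enorm_vec_mx sqr_enorm_rows.
by apply: eq_bigr => t _; rewrite /z_r enorm_tr.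
Qed.

Lemma sqr_enorm_blocks z :
  enorm z ^+ 2 = enorm (z_theta z) ^+ 2 +
    \sum_t (enorm (z_w z t) ^+ 2 + enorm (z_s z t) ^+ 2 +
            enorm (z_v z t) ^+ 2 + enorm (z_r z t) ^+ 2).
Proof.
rewrite /nz (@sqr_enorm_split _ (ntheta N0 N1 N2)); congr (_ + _).
rewrite /nu sqr_enorm_split (sqr_enorm_split (rsubmx _)).
rewrite -/(z_rvec z) sqr_enorm_rvec -!(enorm_vec_mx (lsubmx _)).
rewrite !(sqr_enorm_rows (vec_mx _)) -!big_split; apply: eq_bigr => t _ /=.
by rewrite sqr_enorm_split /z_w /z_s /z_v !enorm_tr addrA.
Qed.

Lemma enorm_W_le_theta z : enorm (z_W z) <= enorm (z_theta z).
Proof.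
rewrite -(@ler_pXn2r _ 2) ?nnegrE // sqr_enorm_theta.
by have := (sqr_ge0 (enorm (z_A z)), sqr_ge0 (enorm (z_V z)),
  sqr_ge0 (enorm (z_b z)), sqr_ge0 (enorm (z_c z))); case=> [[[]]]; lra.
Qed.

Lemma enorm_A_le_theta z : enorm (z_A z) <= enorm (z_theta z).
Proof.
rewrite -(@ler_pXn2r _ 2) ?nnegrE // sqr_enorm_theta.
by have := (sqr_ge0 (enorm (z_W z)), sqr_ge0 (enorm (z_V z)),
  sqr_ge0 (enorm (z_b z)), sqr_ge0 (enorm (z_c z))); case=> [[[]]]; lra.
Qed.

Lemma enorm_V_le_theta z : enorm (z_V z) <= enorm (z_theta z).
Proof.
rewrite -(@ler_pXn2r _ 2) ?nnegrE // sqr_enorm_theta.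
by have := (sqr_ge0 (enorm (z_W z)), sqr_ge0 (enorm (z_A z)),
  sqr_ge0 (enorm (z_b z)), sqr_ge0 (enorm (z_c z))); case=> [[[]]]; lra.
Qed.

Lemma enorm_b_le_theta z : enorm (z_b z) <= enorm (z_theta z).
Proof.
rewrite -(@ler_pXn2r _ 2) ?nnegrE // sqr_enorm_theta.
by have := (sqr_ge0 (enorm (z_W z)), sqr_ge0 (enorm (z_A z)),
  sqr_ge0 (enorm (z_V z)), sqr_ge0 (enorm (z_c z))); case=> [[[]]]; lra.
Qed.

Lemma enorm_c_le_theta z : enorm (z_c z) <= enorm (z_theta z).
Proof.
rewrite -(@ler_pXn2r _ 2) ?nnegrE // sqr_enorm_theta.
by have := (sqr_ge0 (enorm (z_W z)), sqr_ge0 (enorm (z_A z)),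
  sqr_ge0 (enorm (z_V z)), sqr_ge0 (enorm (z_b z))); case=> [[[]]]; lra.
Qed.

Lemma eq_theta_blocks z z' : z_theta z = z_theta z' ->
  [/\ z_A z = z_A z', z_V z = z_V z', z_W z = z_W z', z_b z = z_b z' &
      z_c z = z_c z'].
Proof. by rewrite /z_A /z_V /z_W /z_b /z_c => ->. Qed.

Definition mk_point (th : 'rV[R]_(ntheta N0 N1 N2)) (w s : 'I_3 -> 'cV[R]_N1)
    (v r : 'I_3 -> 'cV[R]_N2) : point :=
  row_mx th (row_mx
    (mxvec (\matrix_t row_mx (w t)^T (s t)^T))
    (row_mx (mxvec (\matrix_t (v t)^T)) (mxvec (\matrix_t (r t)^T)))).

Lemma mk_pointK th w s v r :
  [/\ z_theta (mk_point th w s v r) = th,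
      forall t, z_w (mk_point th w s v r) t = w t,
      forall t, z_s (mk_point th w s v r) t = s t,
      forall t, z_v (mk_point th w s v r) t = v t &
      forall t, z_r (mk_point th w s v r) t = r t].
Proof.
rewrite /z_theta /z_w /z_s /z_v /z_r /z_ws /z_vvec /z_rvec /z_u /mk_point.
split=> [|t|t|t|t]; rewrite ?(row_mxKr, row_mxKl) ?mxvecK ?rowK
  ?(row_mxKr, row_mxKl) ?trmxK //.
Qed.

(** The steps of the recursion are arbitrary, because it is solved both for the
network and for its linearisation. *)
Lemma unroll_exists (th : 'rV[R]_(ntheta N0 N1 N2))
    (f g : 'I_3 -> 'cV[R]_N1 -> 'cV[R]_N1) (h : 'I_3 -> 'cV[R]_N1 -> 'cV[R]_N2)
    (k : 'I_3 -> 'cV[R]_N2 -> 'cV[R]_N2) :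
  exists z : point, z_theta z = th /\ forall t,
    [/\ z_w z t = f t (z_sprev z t), z_s z t = g t (z_w z t),
        z_v z t = h t (z_s z t) & z_r z t = k t (z_v z t)].
Proof.
pose fix S (j : nat) : 'cV[R]_N1 :=
  if j is i.+1 then g (inord i) (f (inord i) (S i)) else 0.
pose w t := f t (S t); pose s (t : 'I_3) := S t.+1.
pose v t := h t (s t); pose r t := k t (v t).
exists (mk_point th w s v r).
have [Eth Ew Es Ev Er] := mk_pointK th w s v r.
split=> // t; rewrite Ew Es Ev Er; split=> //.
  rewrite /w /z_sprev; case: t => -[//|j] ltj /=.
  by rewrite Es /s inordK // ltnW.
by rewrite /s /= inord_val.
Qed.

(** There are twelve blocks besides the parameters, and [12 <= 4 ^+ 2]. *)
Lemma enorm_le_blocks z (M : R) :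
  (forall t, [/\ enorm (z_w z t) <= M, enorm (z_s z t) <= M,
     enorm (z_v z t) <= M & enorm (z_r z t) <= M]) ->
  enorm z <= enorm (z_theta z) + 4 * M.
Proof.
move=> zM; have M0 : 0 <= M by have [h _ _ _] := zM 0; exact: le_trans h.
rewrite -(@ler_pXn2r _ 2) ?nnegrE ?addr_ge0 ?mulr_ge0 //.
rewrite sqr_enorm_blocks (le_trans (_ : _ <= enorm (z_theta z) ^+ 2 +
    \sum_(t < 3) (M ^+ 2 + M ^+ 2 + M ^+ 2 + M ^+ 2))) //.
  rewrite lerD2l; apply: ler_sum => t _.
  by have [h1 h2 h3 h4] := zM t; rewrite !lerD // lerXn2r ?nnegrE.
rewrite sumr_const card_ord; have := mulr_ge0 (enorm_ge0 (z_theta z)) M0.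
have := sqr_ge0 M; rewrite -mulr_natr; nra.
Qed.

(** An error made at some time is amplified by [rho] at each of the remaining
steps, of which there are at most two: this is the factor
[1 + rho + rho ^+ 2].  Reading off the outputs costs one more factor [rho]. *)
Lemma recursion_bound z (rho : R) (ew es ev er : 'I_3 -> R) : 0 <= rho ->
  (forall t, 0 <= ew t) -> (forall t, 0 <= es t) ->
  (forall t, 0 <= ev t) -> (forall t, 0 <= er t) ->
  (forall t, enorm (z_w z t) <= ew t + rho * enorm (z_sprev z t)) ->
  (forall t, enorm (z_s z t) <= es t + enorm (z_w z t)) ->
  (forall t, enorm (z_v z t) <= ev t + rho * enorm (z_s z t)) ->
  (forall t, enorm (z_r z t) <= er t + enorm (z_v z t)) ->
  let E1 := \sum_t (ew t + es t) in let E2 := \sum_t (ev t + er t) in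
  let g := (1 + rho + rho ^+ 2) in
  \sum_t enorm (z_r z t) <= E2 + rho * g * E1 /\
  forall t, [/\ enorm (z_w z t) <= g * E1, enorm (z_s z t) <= g * E1,
     enorm (z_v z t) <= E2 + rho * g * E1 &
     enorm (z_r z t) <= E2 + rho * g * E1].
Proof.
move=> rho0 ew0 es0 ev0 er0 Hw Hs Hv Hr E1 E2 g.
(* This quantity dominates both hidden blocks at time [t]. *)
pose a t := ew t + es t + rho * enorm (z_sprev z t).
have a_ge0 t : 0 <= a t by rewrite !addr_ge0 // mulr_ge0.
have wa t : enorm (z_w z t) <= a t.
  by apply: (le_trans (Hw t)); rewrite lerD2r lerDl.
have sa t : enorm (z_s z t) <= a t.
  by have := Hs t; have := Hw t; rewrite /a; lra.
have ev_er t : ev t + er t <= E2.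
  by apply: (@le_term_sum _ _ (fun t => ev t + er t)) => i; rewrite addr_ge0.
have suma : \sum_t a t <= g * E1.
  pose e t := ew t + es t.
  have e0 t : 0 <= e t by rewrite addr_ge0.
  have a0E : a 0 = e 0 by rewrite /a /z_sprev /= enorm0 mulr0 addr0.
  have a1E : a 1 <= e 1 + rho * e 0.
    by rewrite lerD2l ler_wpM2l // -a0E (_ : z_sprev z 1 = z_s z 0) // /z_sprev /=;
      congr z_s; apply/val_inj; rewrite /= inordK.
  have a2E : a (inord 2) <= e (inord 2) + rho * (e 1 + rho * e 0).
    rewrite lerD2l ler_wpM2l // (le_trans _ a1E) //.
    rewrite (_ : z_sprev z (inord 2) = z_s z 1) // /z_sprev inordK //.
    by congr z_s; apply/val_inj; rewrite /= inordK.
  have sum3 (f : 'I_3 -> R) : \sum_t f t = f 0 + f 1 + f (inord 2).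
    rewrite !big_ord_recr big_ord0 /= add0r.
    by congr (f _ + f _ + f _); apply/val_inj; rewrite /= ?inordK.
  have -> : E1 = e 0 + e 1 + e (inord 2) by rewrite /E1 sum3.
  rewrite sum3 a0E (le_trans (lerD (lerD (lexx _) a1E) a2E)) // -subr_ge0.
  rewrite (_ : _ - _ = rho ^+ 2 * e 1 + (rho + rho ^+ 2) * e (inord 2)).
    by rewrite addr_ge0 // mulr_ge0 // ?addr_ge0 // sqr_ge0.
  by rewrite /g; ring.
have sumg : \sum_t enorm (z_s z t) <= g * E1.
  by apply: le_trans suma; exact: ler_sum.
have ag t : a t <= g * E1 by apply: le_trans suma; exact: le_term_sum.
have sg t : rho * enorm (z_s z t) <= rho * g * E1.
  by rewrite -mulrA ler_wpM2l // (le_trans (sa t)).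
have rv t : enorm (z_r z t) <= ev t + er t + rho * enorm (z_s z t).
  by rewrite (le_trans (Hr t)) // [ev t + _]addrC -addrA lerD2l.
split.
  rewrite (le_trans (ler_sum _ (fun t _ => rv t))) // big_split /= lerD2l.
  by rewrite -mulr_sumr -mulrA ler_wpM2l.
move=> t; split; [exact: le_trans (ag t)|exact: le_trans (ag t)| |].
  rewrite (le_trans (Hv t)) // lerD // (le_trans _ (ev_er t)) // lerDl //.
by rewrite (le_trans (rv t)) // lerD.
Qed.
End Blocks.

(** * One-sided expansions along rays *)

Section Rays.
Context {R : realType}.
Implicit Types (p q c tau : R).

Lemma near_right_le (e : R) : 0 < e -> \forall tau \near 0^'+, 0 < tau <= e.
Proof.
move=> e0; near=> tau; apply/andP; split; first by near: tau; exact: nbhs_right_gt.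
by near: tau; exact: nbhs_right_le.
Unshelve. all: by end_near. Qed.

(** A one-sided expansion that is exact near zero.  The value and the slope are
explicit because they are compared later on; of the last coefficient only the
sign at a minimizer matters, which is found without knowing it. *)
Definition ray2 (f : R -> R) p q :=
  exists c, \forall tau \near 0^'+, f tau = p + tau * q + tau ^+ 2 * c.

Lemma ray2D f g p q p' q' : ray2 f p q -> ray2 g p' q' ->
  ray2 (fun tau => f tau + g tau) (p + p') (q + q').
Proof.
move=> [c fc] [c' gc]; exists (c + c'); near=> tau.
rewrite (near fc tau) ?(near gc tau) //; ring.
Unshelve. all: by end_near. Qed.

Lemma ray2Z f p q a : ray2 f p q ->
  ray2 (fun tau => a * f tau) (a * p) (a * q).
Proof.
move=> [c fc]; exists (a * c); near=> tau.
rewrite (near fc tau) //; ring.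
Unshelve. all: by end_near. Qed.

Lemma ray2_sum (I : finType) (f : I -> R -> R) (p q : I -> R) :
  (forall i, ray2 (f i) (p i) (q i)) ->
  ray2 (fun tau => \sum_i f i tau) (\sum_i p i) (\sum_i q i).
Proof.
move=> /choice[c /filter_forall fE]; exists (\sum_i c i).
near=> tau.
rewrite !mulr_sumr -!big_split /=; apply: eq_bigr => i _.
by move: i; near: tau; exact: fE.
Unshelve. all: by end_near. Qed.

(** For small [tau] the constant term dominates the two others. *)
Lemma ray_ge0 p q c : 0 < p ->
  \forall tau \near 0^'+, 0 <= p + tau * q + tau ^+ 2 * c.
Proof.
move=> p0; have d0 : 0 < `|q| + `|c| + 1 by rewrite ltr_wpDl ?addr_ge0.
near=> tau.
have /andP[t0 t1] : 0 < tau <= 1.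
  by near: tau; apply: near_right_le.
have /andP[_ te] : 0 < tau <= p / (`|q| + `|c| + 1).
  by near: tau; apply: near_right_le; rewrite divr_gt0.
move: te; rewrite ler_pdivlMr // => te.
have := ler_wpM2l (ltW t0) (ler_norm (- q)).
have tt : tau ^+ 2 <= tau by rewrite expr2 ger_pMl.
have := ler_wpM2l (sqr_ge0 tau) (ler_norm (- c)).
have := ler_wpM2r (normr_ge0 c) tt.
rewrite !normrN !mulrN; lra.
Unshelve. all: by end_near. Qed.

(** The one-sided derivative of the absolute value at [p] in direction [q]. *)
Definition dabs p q := if 0 < p then q else if p < 0 then - q else `|q|.

Lemma dabs0 q : dabs 0 q = `|q|.
Proof. by rewrite /dabs ltxx. Qed.

Lemma dabsN p : dabs p (- p) = - `|p|.
Proof.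
rewrite /dabs; have [p0|p0|<-] := ltgtP 0 p.
- by rewrite gtr0_norm.
- by rewrite ltr0_norm.
- by rewrite oppr0 normr0 oppr0.
Qed.

(** The sign of a polynomial just to the right of zero is the sign of its first
nonzero coefficient. *)
Lemma abs_ray2 p q c (f : R -> R) :
  (\forall tau \near 0^'+, f tau = p + tau * q + tau ^+ 2 * c) ->
  ray2 (fun tau => `|f tau|) `|p| (dabs p q).
Proof.
move=> fE; rewrite /dabs.
have [p0|p0|p0] := ltgtP 0 p.
- exists c; near=> tau; rewrite (near fE tau) // (gtr0_norm p0) ger0_norm //.
  by near: tau; exact: ray_ge0.
- exists (- c); near=> tau; rewrite (near fE tau) // (ltr0_norm p0) ler0_norm.
    ring.
  have : 0 <= - p + tau * (- q) + tau ^+ 2 * (- c).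
    by near: tau; apply: ray_ge0; rewrite oppr_gt0.
  by lra.
rewrite -{}p0 in fE *; rewrite normr0; have [q0|q0|q0] := ltgtP 0 q.
- exists c; near=> tau; rewrite (near fE tau) // !add0r (gtr0_norm q0).
  rewrite expr2 -mulrA -mulrDr ger0_norm // mulr_ge0 //.
  have : 0 <= q + tau * c + tau ^+ 2 * 0 by near: tau; apply: ray_ge0.
  by rewrite mulr0 addr0.
- exists (- c); near=> tau; rewrite (near fE tau) // !add0r (ltr0_norm q0).
  rewrite expr2 -!mulrA -!mulrDr ler0_norm.
    ring.
  rewrite mulr_ge0_le0 //.
  have : 0 <= - q + tau * - c + tau ^+ 2 * 0.
    by near: tau; apply: ray_ge0; rewrite oppr_gt0.
  by rewrite mulr0; lra.
- rewrite -{}q0 in fE *; exists `|c|; near=> tau; rewrite (near fE tau) // normr0 !mulr0 !add0r.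
  by rewrite normrM ger0_norm ?sqr_ge0.
Unshelve. all: by end_near. Qed.

(** The one-sided derivative of [l1norm] at [P] in direction [Q]. *)
Definition dl1norm m n (P Q : 'M[R]_(m, n)) : R :=
  \sum_i \sum_j dabs (P i j) (Q i j).

Lemma dl1norm0 m n (Q : 'M[R]_(m, n)) : dl1norm 0 Q = l1norm Q.
Proof.
by apply: eq_bigr => i _; apply: eq_bigr => j _; rewrite mxE dabs0.
Qed.

Lemma dl1normN m n (P : 'M[R]_(m, n)) : dl1norm P (- P) = - l1norm P.
Proof.
rewrite /l1norm -sumrN; apply: eq_bigr => i _.
by rewrite -sumrN; apply: eq_bigr => j _; rewrite mxE dabsN.
Qed.

Lemma l1norm_ray2 m n (f : R -> 'M[R]_(m, n)) (P Q C : 'M[R]_(m, n)) :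
  (\forall tau \near 0^'+, f tau = P + tau *: Q + tau ^+ 2 *: C) ->
  ray2 (fun tau => l1norm (f tau)) (l1norm P) (dl1norm P Q).
Proof.
move=> fE; apply: ray2_sum => i; apply: ray2_sum => j.
apply: (@abs_ray2 _ _ (C i j)); near=> tau.
by rewrite (near fE tau) // !mxE.
Unshelve. all: by end_near. Qed.

(** The quadratic remainder contributes [tau *: c] to the difference quotient. *)
Lemma dderivE (U V : normedModType R) (f : U -> V) x d (b c : V) :
  (\forall tau \near 0^'+, f (x + tau *: d) = f x + tau *: b + tau ^+ 2 *: c) ->
  dquot f x d tau @[tau --> 0^'+] --> b.
Proof.
move=> fE; have -> : b = b + (0 : R) *: c by rewrite scale0r addr0.
apply: (@cvg_trans _ ((b + tau *: c) @[tau --> 0^'+])).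
  apply: near_eq_cvg; near=> tau; rewrite /dquot (near fE tau) //.
  have t0 : tau != 0 by near: tau; exact: nbhs_right_neq.
  have -> : f x + tau *: b + tau ^+ 2 *: c - f x = tau *: (b + tau *: c).
    by rewrite addrAC [f x + _]addrC addrK scalerDr scalerA.
  by rewrite scalerA mulVf // scale1r.
apply: cvgD; first exact: cvg_cst.
apply: cvgZr_tmp.
by apply: cvg_at_right_filter; exact: cvg_id.
Unshelve. all: by end_near. Qed.

(** The second difference quotient is eventually constant, because the expansion
is exact. *)
Lemma ray2_dderiv (U : normedModType R) (f : U -> R) x d (q : R) :
  ray2 (fun tau => f (x + tau *: d)) (f x) q ->
  [/\ ddifferentiable f x d, dderiv f x d = q &
    exists c, (\forall tau \near 0^'+, f (x + tau *: d) = f x + tau * q + tau ^+ 2 * c)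
     /\ ddifferentiable2 f x d /\ dderiv2 f x d = 2 * c].
Proof.
move=> [c fE].
have dq : dquot f x d tau @[tau --> 0^'+] --> q by apply: dderivE fE.
have Ed : dderiv f x d = q by apply: cvg_lim dq.
split=> //; first by apply/cvg_ex; exists q.
exists c; split => //.
suff dq2 : dquot2 f x d tau @[tau --> 0^'+] --> 2 * c.
  by split; [apply/cvg_ex; exists (2 * c) | exact: cvg_lim dq2].
apply: (@cvg_trans _ ((2 * c : R) @[tau --> (0 : R)^'+])); last exact: cvg_cst.
apply: near_eq_cvg; near=> tau.
rewrite /dquot2 (near fE tau) // Ed /GRing.scale /=.
have t0 : tau != 0 by near: tau; exact: nbhs_right_neq.
by field.
Unshelve. all: by end_near. Qed.

End Rays.

(** * The activation and its one-sided derivative *)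

Section Activation.
Context {R : realType}.
Variable alpha : R.
Hypothesis halpha : 0 <= alpha < 1.

Lemma lreluE (a : R) : Num.max a (alpha * a) = if 0 <= a then a else alpha * a.
Proof.
have /andP[al0 al1] := halpha.
have [a0|a0] := leP 0 a; first by rewrite (max_idPl _) //; nra.
by rewrite (max_idPr _) //; nra.
Qed.

Lemma lrelu_lipschitz (a b : R) :
  `|Num.max a (alpha * a) - Num.max b (alpha * b)| <= `|a - b|.
Proof.
have /andP[al0 al1] := halpha; have ab := ler_norm (a - b).
have ba : b - a <= `|a - b| by rewrite distrC ler_norm.
rewrite !lreluE; have [a0|a0] := leP 0 a; have [b0|b0] := leP 0 b => //.
- by rewrite ler_norml; apply/andP; split; nra.
- by rewrite ler_norml; apply/andP; split; nra.
- by rewrite -mulrBr normrM ger0_norm // ler_piMl // ltW.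
Qed.

(** At the kink [a = 0] the activation is positively homogeneous, hence equal to
its own one-sided derivative. *)
Definition dlrelu (a d : R) : R :=
  if 0 < a then d else if a < 0 then alpha * d else Num.max d (alpha * d).

Lemma lrelu_ray (a d : R) : \forall tau \near 0^'+,
  Num.max (a + tau * d) (alpha * (a + tau * d)) =
  Num.max a (alpha * a) + tau * dlrelu a d.
Proof.
rewrite /dlrelu; have [a0|a0|<-] := ltgtP 0 a.
- near=> tau; rewrite !lreluE (ltW a0) ifT //.
  rewrite -[leRHS]addr0 -[X in _ + X](mulr0 (tau ^+ 2)).
  by near: tau; exact: ray_ge0.
- near=> tau; rewrite !lreluE (lt_geF a0).
  have [|_] := leP 0 (a + tau * d); last by ring.
  have : 0 <= - a + tau * (- d) + tau ^+ 2 * 0.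
    by near: tau; apply: ray_ge0; rewrite oppr_gt0.
  rewrite mulr0 addr0 => h1 h2.
  have e : a + tau * d = 0 by lra.
  by rewrite e mulrCA -mulrDr e mulr0.
- near=> tau; have t0 : 0 < tau by near: tau; exact: nbhs_right_gt.
  rewrite !lreluE !add0r lexx add0r pmulr_rge0 //.
  by case: ifP => // _; rewrite mulrCA.
Unshelve. all: by end_near. Qed.

Lemma dlrelu_lipschitz (a d e : R) :
  `|dlrelu a d - dlrelu a e| <= `|d - e|.
Proof.
have /andP[al0 al1] := halpha.
rewrite /dlrelu; case: ifP => // _; case: ifP => // _; last exact: lrelu_lipschitz.
by rewrite -mulrBr normrM ger0_norm // ler_piMl // ltW.
Qed.

Definition dsigma n (w d : 'cV[R]_n) : 'cV[R]_n :=
  \matrix_(i, j) dlrelu (w i j) (d i j).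

Lemma sigma_ray n (w d : 'cV[R]_n) : \forall tau \near 0^'+,
  sigma alpha (w + tau *: d) = sigma alpha w + tau *: dsigma w d.
Proof.
have : \forall tau \near 0^'+, forall i, sigma alpha (w + tau *: d) i 0 =
  sigma alpha w i 0 + tau * dsigma w d i 0.
  apply: filter_forall => i; near=> tau; rewrite !mxE.
  by near: tau; exact: lrelu_ray.
move=> H; near=> tau; apply/matrixP => i j; rewrite (ord1 j).
by rewrite (near H tau) // !mxE.
Unshelve. all: by end_near. Qed.

Lemma dderiv_sigma n (w d : 'cV[R]_n) :
  dderiv (@sigma R alpha n) w d = dsigma w d.
Proof.
apply: cvg_lim => //; apply: (@dderivE _ _ _ _ _ _ _ 0).
by near do rewrite scaler0 addr0; exact: sigma_ray.
Unshelve. all: by end_near. Qed.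

Lemma le_enorm_entry m n (A B : 'M[R]_(m, n)) :
  (forall i j, `|A i j| <= `|B i j|) -> enorm A <= enorm B.
Proof.
move=> AB; rewrite -(@ler_pXn2r _ 2) ?nnegrE // !enorm_sqr.
apply: ler_sum => i _; apply: ler_sum => j _.
by rewrite -!expr2 -[A i j ^+ 2]real_normK ?num_real // -[B i j ^+ 2]real_normK
  ?num_real // lerXn2r ?nnegrE.
Qed.

Lemma sigma_nonexpansive n (w w' : 'cV[R]_n) :
  enorm (sigma alpha w - sigma alpha w') <= enorm (w - w').
Proof. by apply: le_enorm_entry => i j; rewrite !mxE lrelu_lipschitz. Qed.

Lemma dsigma_nonexpansive n (w d d' : 'cV[R]_n) :
  enorm (dsigma w d - dsigma w d') <= enorm (d - d').
Proof. by apply: le_enorm_entry => i j; rewrite !mxE dlrelu_lipschitz. Qed.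

End Activation.

(** * Residuals of the network equations *)

Section Residuals.
Context {R : realType} {N0 N1 N2 : nat}.
Variables (lambda alpha : R) (x : 'I_3 -> 'cV[R]_N0) (y : 'I_3 -> 'cV[R]_N2).
Hypothesis halpha : 0 <= alpha < 1.
Notation point := ('rV[R]_(nz N0 N1 N2)).
Implicit Types (z d : point) (t : 'I_3).

Definition res_w z t :=
  z_w z t - z_W z *m z_sprev z t - z_A z *m x t - z_b z.
Definition res_s z t := z_s z t - sigma alpha (z_w z t).
Definition res_v z t := z_v z t - z_V z *m z_s z t - z_c z.
Definition res_r z t := z_r z t - sigma alpha (z_v z t).

(** The first-order coefficients of the residuals along [z + tau *: d]. *)
Definition lin_w z d t :=
  z_w d t - (z_W d *m z_sprev z t + z_W z *m z_sprev d t + z_A d *m x t + z_b d).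
Definition lin_s z d t := z_s d t - dsigma alpha (z_w z t) (z_w d t).
Definition lin_v z d t :=
  z_v d t - (z_V d *m z_s z t + z_V z *m z_s d t + z_c d).
Definition lin_r z d t := z_r d t - dsigma alpha (z_v z t) (z_v d t).

(** The residual is bilinear in parameters and states, so that the expansion
ends with the product of the two increments. *)
Lemma res_w_ray z d (tau : R) t : res_w (z + tau *: d) t =
  res_w z t + tau *: lin_w z d t - tau ^+ 2 *: (z_W d *m z_sprev d t).
Proof.
rewrite /res_w /lin_w !z_linE !(mulmxDl, mulmxDr) -!(scalemxAl, scalemxAr).
rewrite scalerA -expr2.
by apply/matrixP => i j; rewrite !mxE; ring.
Qed.

Lemma res_v_ray z d (tau : R) t : res_v (z + tau *: d) t =
  res_v z t + tau *: lin_v z d t - tau ^+ 2 *: (z_V d *m z_s d t).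
Proof.
rewrite /res_v /lin_v !z_linE !(mulmxDl, mulmxDr) -!(scalemxAl, scalemxAr).
rewrite scalerA -expr2.
by apply/matrixP => i j; rewrite !mxE; ring.
Qed.

Lemma res_s_ray z d t : \forall tau \near 0^'+,
  res_s (z + tau *: d) t = res_s z t + tau *: lin_s z d t.
Proof.
near=> tau; rewrite /res_s /lin_s !z_linE.
rewrite (_ : sigma _ _ =
    sigma alpha (z_w z t) + tau *: dsigma alpha (z_w z t) (z_w d t)).
  by apply/matrixP => i j; rewrite !mxE; ring.
by near: tau; exact: sigma_ray.
Unshelve. all: by end_near. Qed.

Lemma res_r_ray z d t : \forall tau \near 0^'+,
  res_r (z + tau *: d) t = res_r z t + tau *: lin_r z d t.
Proof.
near=> tau; rewrite /res_r /lin_r !z_linE.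
rewrite (_ : sigma _ _ =
    sigma alpha (z_v z t) + tau *: dsigma alpha (z_v z t) (z_v d t)).
  by apply/matrixP => i j; rewrite !mxE; ring.
by near: tau; exact: sigma_ray.
Unshelve. all: by end_near. Qed.

Lemma F0RNN_res z : F0RNN alpha x z <->
  forall t, [/\ res_w z t = 0, res_s z t = 0, res_v z t = 0 & res_r z t = 0].
Proof.
have sub2 n (a b c : 'cV[R]_n) : a - b - c = a - (b + c).
  by rewrite opprD addrA.
split=> H t; have [h1 h2 h3 h4] := H t.
  by rewrite /res_w /res_s /res_v /res_r !sub2 !addrA {1}h1 {1}h2 {1}h3 {1}h4 !subrr.
by split; apply: subr0_eq; rewrite -?addrA -?sub2 // ?addrA -?sub2.
Qed.

Lemma tangent_formula_lin z d : tangent_formula alpha x z d <->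
  forall t, [/\ lin_w z d t = 0, lin_s z d t = 0, lin_v z d t = 0 &
                lin_r z d t = 0].
Proof.
split=> H t; have [h1 h2 h3 h4] := H t.
  by rewrite /lin_w /lin_s /lin_v /lin_r {1}h1 {1}h2 {1}h3 {1}h4
    !(dderiv_sigma halpha) !subrr.
by split; rewrite ?(dderiv_sigma halpha) //; apply: subr0_eq.
Qed.

Definition pen1 z := \sum_t (l1norm (res_w z t) + l1norm (res_s z t)).
Definition pen2 z := \sum_t (l1norm (res_v z t) + l1norm (res_r z t)).

(** The one-sided derivatives of the penalties, by the chain rule. *)
Definition dpen1 z d := \sum_t (dl1norm (res_w z t) (lin_w z d t) +
  dl1norm (res_s z t) (lin_s z d t)).
Definition dpen2 z d := \sum_t (dl1norm (res_v z t) (lin_v z d t) +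
  dl1norm (res_r z t) (lin_r z d t)).

Lemma pen1_ge0 z : 0 <= pen1 z.
Proof. by apply: sumr_ge0 => t _; rewrite addr_ge0 ?l1norm_ge0. Qed.

Lemma pen2_ge0 z : 0 <= pen2 z.
Proof. by apply: sumr_ge0 => t _; rewrite addr_ge0 ?l1norm_ge0. Qed.

Lemma F0RNN_pen z : F0RNN alpha x z <-> pen1 z = 0 /\ pen2 z = 0.
Proof.
split=> [/F0RNN_res z0|[p1 p2]].
  split; apply: big1 => t _; have [h1 h2 h3 h4] := z0 t;
  by rewrite ?(h1, h2, h3, h4) !l1norm0 addr0.
apply/F0RNN_res => t; move/eqP: p1; rewrite psumr_eq0; last first.
  by move=> i _; rewrite addr_ge0 ?l1norm_ge0.
move=> /allP/(_ t (mem_index_enum _)) /=; rewrite paddr_eq0 ?l1norm_ge0 //.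
move=> /andP[/eqP/l1norm_eq0-> /eqP/l1norm_eq0->].
move/eqP: p2; rewrite psumr_eq0; last first.
  by move=> i _; rewrite addr_ge0 ?l1norm_ge0.
move=> /allP/(_ t (mem_index_enum _)) /=; rewrite paddr_eq0 ?l1norm_ge0 //.
by move=> /andP[/eqP/l1norm_eq0-> /eqP/l1norm_eq0->].
Qed.

Lemma pen1_ray2 z d :
  ray2 (fun tau => pen1 (z + tau *: d)) (pen1 z) (dpen1 z d).
Proof.
apply: ray2_sum => t; apply: ray2D.
  apply: (l1norm_ray2 (C := - (z_W d *m z_sprev d t))); near=> tau.
  by rewrite res_w_ray scalerN.
apply: (l1norm_ray2 (C := 0)); near=> tau.
by rewrite scaler0 addr0; near: tau; exact: res_s_ray.
Unshelve. all: by end_near. Qed.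

Lemma pen2_ray2 z d :
  ray2 (fun tau => pen2 (z + tau *: d)) (pen2 z) (dpen2 z d).
Proof.
apply: ray2_sum => t; apply: ray2D.
  apply: (l1norm_ray2 (C := - (z_V d *m z_s d t))); near=> tau.
  by rewrite res_v_ray scalerN.
apply: (l1norm_ray2 (C := 0)); near=> tau.
by rewrite scaler0 addr0; near: tau; exact: res_r_ray.
Unshelve. all: by end_near. Qed.

(** * The smooth part of the objective *)

(** The derivative of [F] at [z] and its constant second derivative. *)
Definition dF z d : R :=
  mxdot (z_rvec z - yvec y) (z_rvec d) / 3 +
  2 * lambda * mxdot (z_theta z) (z_theta d).

Definition hessF d d' : R :=
  mxdot (z_rvec d) (z_rvec d') / 3 + 2 * lambda * mxdot (z_theta d) (z_theta d').

Lemma F_ray z d (tau : R) : F lambda y (z + tau *: d) =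
  F lambda y z + tau * dF z d + tau ^+ 2 * (hessF d d / 2).
Proof.
rewrite /F /dF /hessF !z_linE !enorm_sqr addrAC.
rewrite !(mxdotDl, mxdotDr, mxdotZl, mxdotZr).
rewrite (mxdotC (z_theta d) (z_theta z)) (mxdotC (z_rvec d) (z_rvec z)).
rewrite (mxdotC (z_rvec d) (- yvec y)).
by field.
Qed.

Lemma dF_linear z (a : R) d d' : dF z (a *: d + d') = a * dF z d + dF z d'.
Proof.
rewrite /dF [a *: d + d']addrC !z_linE !(mxdotDr, mxdotZr); ring.
Qed.

Lemma dF_ray z d d' (tau : R) : dF (z + tau *: d) d' = dF z d' + tau * hessF d d'.
Proof.
rewrite /dF /hessF !z_linE addrAC !(mxdotDl, mxdotZl); ring.
Qed.

Lemma hessF_ge0 d : 0 < lambda -> 0 <= hessF d d.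
Proof.
move=> l0; rewrite /hessF addr_ge0 ?divr_ge0 ?mxdot_ge0 //.
by rewrite mulr_ge0 ?mxdot_ge0 // mulr_ge0 // ltW.
Qed.

Definition dTheta (beta1 beta2 : R) z d : R :=
  dF z d + beta1 * dpen1 z d + beta2 * dpen2 z d.

Lemma ThetaE (beta1 beta2 : R) z : Theta lambda alpha x y beta1 beta2 z =
  F lambda y z + beta1 * pen1 z + beta2 * pen2 z.
Proof. by []. Qed.

Lemma Theta_ray2 beta1 beta2 z d :
  ray2 (fun tau => Theta lambda alpha x y beta1 beta2 (z + tau *: d))
    (Theta lambda alpha x y beta1 beta2 z) (dTheta beta1 beta2 z d).
Proof.
apply: ray2D; last exact/ray2Z/pen2_ray2.
apply: ray2D; last exact/ray2Z/pen1_ray2.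
by exists (hessF d d / 2); near=> tau; exact: F_ray.
Unshelve. all: by end_near. Qed.

Lemma F_ray2 z d :
  ray2 (fun tau => F lambda y (z + tau *: d)) (F lambda y z) (dF z d).
Proof.
by exists (hessF d d / 2); near=> tau; exact: F_ray.
Unshelve. all: by end_near. Qed.

End Residuals.

(** * Continuity, and compactness of the sets of minimizers *)

Section Continuity.
Context {R : realType} {T : topologicalType}.

(** Continuity entry by entry: this form is stable under products of matrices of
any size, and it is what the entrywise norms below consume. *)
Definition mcont m n (f : T -> 'M[R]_(m, n)) :=
  forall i j, continuous (fun z => f z i j).

Lemma continuous_sum (I : finType) (f : I -> T -> R) :
  (forall i, continuous (f i)) -> continuous (fun z => \sum_i f i z).
Proof.
move=> fc z; apply: (@cvg_big R^o I +%R 0) => [|i _]; last exact: fc.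
exact: add_continuous.
Qed.

Lemma mcont_cst m n (A : 'M[R]_(m, n)) : mcont (fun=> A).
Proof. by move=> i j z; exact: cvg_cst. Qed.

Lemma mcontD m n (f g : T -> 'M[R]_(m, n)) :
  mcont f -> mcont g -> mcont (fun z => f z + g z).
Proof.
move=> fc gc i j; rewrite (_ : (fun z => _) = fun z => f z i j + g z i j).
  by move=> z; apply: (cvgD (fc i j z) (gc i j z)).
by apply/funext => z'; rewrite mxE.
Qed.

Lemma mcontN m n (f : T -> 'M[R]_(m, n)) :
  mcont f -> mcont (fun z => - f z).
Proof.
move=> fc i j; rewrite (_ : (fun z => _) = fun z => - f z i j).
  by move=> z; apply: (cvgN (fc i j z)).
by apply/funext => z'; rewrite mxE.
Qed.

Lemma mcontM m n p (f : T -> 'M[R]_(m, n)) (g : T -> 'M[R]_(n, p)) :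
  mcont f -> mcont g -> mcont (fun z => f z *m g z).
Proof.
move=> fc gc i j.
rewrite (_ : (fun z => _) = fun z => \sum_k f z i k * g z k j).
  by apply: continuous_sum => k z; exact: (cvgM (fc i k z) (gc k j z)).
by apply/funext => z'; rewrite mxE.
Qed.

Lemma mcont_map m n (h : R -> R) (f : T -> 'M[R]_(m, n)) :
  continuous h -> mcont f -> mcont (fun z => map_mx h (f z)).
Proof.
move=> hc fc i j.
rewrite (_ : (fun z => _) = h \o (fun z => f z i j)).
  by move=> z; apply: continuous_comp; [exact: fc|exact: hc].
by apply/funext => z'; rewrite mxE.
Qed.

Lemma continuous_l1norm m n (f : T -> 'M[R]_(m, n)) :
  mcont f -> continuous (fun z => l1norm (f z)).
Proof.
move=> fc; apply: continuous_sum => i; apply: continuous_sum => j z.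
exact: (cvg_norm (fc i j z)).
Qed.

Lemma continuous_mxdot m n (f g : T -> 'M[R]_(m, n)) :
  mcont f -> mcont g -> continuous (fun z => mxdot (f z) (g z)).
Proof.
move=> fc gc; apply: continuous_sum => i; apply: continuous_sum => j z.
exact: (cvgM (fc i j z) (gc i j z)).
Qed.

End Continuity.
Arguments mcont_cst {R T m n} A.

Section BlockContinuity.
Context {R : realType} {N0 N1 N2 : nat}.
Variables (lambda alpha : R) (x : 'I_3 -> 'cV[R]_N0) (y : 'I_3 -> 'cV[R]_N2).
Hypothesis halpha : 0 <= alpha < 1.
Notation point := ('rV[R]_(nz N0 N1 N2)).
Implicit Types (z d : point) (t : 'I_3).

(** The entries of all blocks are coordinates of the point. *)
Lemma mcont_coord m n (f : point -> 'M[R]_(m, n)) :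
  (forall i j, exists k, forall z, f z i j = z 0 k) -> mcont f.
Proof.
move=> fE i j; have [k fk] := fE i j.
by rewrite (_ : (fun z => _) = fun z => z 0 k);
  [exact: coord_continuous|exact/funext].
Qed.

Lemma mcont_theta : mcont (fun z => z_theta z).
Proof. by apply: mcont_coord => i j; rewrite (ord1 i); eexists => z; rewrite !mxE. Qed.

Lemma mcont_A : mcont (fun z => z_A z).
Proof. by apply: mcont_coord => i j; eexists => z; rewrite !mxE. Qed.

Lemma mcont_V : mcont (fun z => z_V z).
Proof. by apply: mcont_coord => i j; eexists => z; rewrite !mxE. Qed.

Lemma mcont_W : mcont (fun z => z_W z).
Proof. by apply: mcont_coord => i j; eexists => z; rewrite !mxE. Qed.

Lemma mcont_b : mcont (fun z => z_b z).
Proof. by apply: mcont_coord => i j; rewrite (ord1 j); eexists => z; rewrite !mxE. Qed.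

Lemma mcont_c : mcont (fun z => z_c z).
Proof. by apply: mcont_coord => i j; rewrite (ord1 j); eexists => z; rewrite !mxE. Qed.

Lemma mcont_w t : mcont (fun z => z_w z t).
Proof. by apply: mcont_coord => i j; rewrite (ord1 j); eexists => z; rewrite !mxE. Qed.

Lemma mcont_s t : mcont (fun z => z_s z t).
Proof. by apply: mcont_coord => i j; rewrite (ord1 j); eexists => z; rewrite !mxE. Qed.

Lemma mcont_v t : mcont (fun z => z_v z t).
Proof. by apply: mcont_coord => i j; rewrite (ord1 j); eexists => z; rewrite !mxE. Qed.

Lemma mcont_r t : mcont (fun z => z_r z t).
Proof. by apply: mcont_coord => i j; rewrite (ord1 j); eexists => z; rewrite !mxE. Qed.

Lemma mcont_rvec : mcont (fun z => z_rvec z).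
Proof. by apply: mcont_coord => i j; rewrite (ord1 i); eexists => z; rewrite !mxE. Qed.

Lemma mcont_sprev t : mcont (fun z => z_sprev z t).
Proof.
rewrite /z_sprev; case: (t : nat) => [|k]; first exact: mcont_cst.
exact: mcont_s.
Qed.

Lemma continuous_lrelu : continuous (fun e : R => Num.max e (alpha * e)).
Proof.
move=> e; apply: (@continuous_max _ _ idfun (fun e : R => alpha * e)).
  exact: cvg_id.
by apply: cvgMl_tmp; exact: cvg_id.
Qed.

Lemma mcont_res_w t : mcont (fun z => res_w x z t).
Proof.
apply: mcontD (mcontN mcont_b); apply: mcontD; last first.
  by apply: mcontN; apply: mcontM mcont_A (mcont_cst _).
apply: mcontD (@mcont_w _) _.
by apply: mcontN; apply: mcontM mcont_W (@mcont_sprev _).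
Qed.

Lemma mcont_res_v t : mcont (fun z => res_v z t).
Proof.
apply: mcontD (mcontN mcont_c); apply: mcontD (@mcont_v _) _.
by apply: mcontN; apply: mcontM mcont_V (@mcont_s _).
Qed.

Lemma mcont_res_s t : mcont (fun z => res_s alpha z t).
Proof.
apply: mcontD (@mcont_s _) (mcontN _).
by apply: mcont_map (@mcont_w _); exact: continuous_lrelu.
Qed.

Lemma mcont_res_r t : mcont (fun z => res_r alpha z t).
Proof.
apply: mcontD (@mcont_r _) (mcontN _).
by apply: mcont_map (@mcont_v _); exact: continuous_lrelu.
Qed.

Lemma continuous_pen1 : continuous (@pen1 R N0 N1 N2 alpha x).
Proof.
apply: continuous_sum => t z.
exact: (cvgD (continuous_l1norm (@mcont_res_w t) (x := z))
  (continuous_l1norm (@mcont_res_s t) (x := z))).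
Qed.

Lemma continuous_pen2 : continuous (@pen2 R N0 N1 N2 alpha).
Proof.
apply: continuous_sum => t z.
exact: (cvgD (continuous_l1norm (@mcont_res_v t) (x := z))
  (continuous_l1norm (@mcont_res_r t) (x := z))).
Qed.

Lemma continuous_F : continuous (F lambda y : point -> R).
Proof.
rewrite (_ : F _ _ = fun z => mxdot (z_rvec z - yvec y) (z_rvec z - yvec y) / 6
    + lambda * mxdot (z_theta z) (z_theta z)); last first.
  by apply/funext => z; rewrite /F !enorm_sqr.
have h : mcont (fun z : point => z_rvec z - yvec y).
  by apply: mcontD mcont_rvec (mcontN (mcont_cst _)).
move=> z; exact: (cvgD (cvgMr_tmp (continuous_mxdot h h (x := z)))
  (cvgMl_tmp (continuous_mxdot mcont_theta mcont_theta (x := z)))).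
Qed.

Lemma continuous_Theta beta1 beta2 : continuous (@Theta R N0 N1 N2 lambda alpha x y beta1 beta2).
Proof.
move=> z; exact: (cvgD (cvgD (@continuous_F z)
  (cvgMl_tmp (@continuous_pen1 z))) (cvgMl_tmp (@continuous_pen2 z))).
Qed.

Lemma continuous_dF z : continuous (@dF R N0 N1 N2 lambda y z).
Proof.
move=> d; exact: (cvgD
  (cvgMr_tmp (continuous_mxdot (mcont_cst _) mcont_rvec (x := d)))
  (cvgMl_tmp (continuous_mxdot (mcont_cst _) mcont_theta (x := d)))).
Qed.

Lemma continuous_hessF : continuous (fun d : point => hessF lambda d d).
Proof.
move=> d; exact: (cvgD
  (cvgMr_tmp (continuous_mxdot mcont_rvec mcont_rvec (x := d)))
  (cvgMl_tmp (continuous_mxdot mcont_theta mcont_theta (x := d)))).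
Qed.

(** The feasible set is the common zero set of the two continuous penalties. *)
Lemma closed_F0RNN : closed (F0RNN alpha x : set point).
Proof.
rewrite (_ : F0RNN alpha x = @pen1 R N0 N1 N2 alpha x @^-1` [set 0] `&`
   (@pen2 R N0 N1 N2 alpha) @^-1` [set 0]).
  by apply: closedI; apply: preimage_closed => //; try exact: closed_eq;
   move=> ? _; first [exact: continuous_pen1|exact: continuous_pen2].
by apply/seteqP; split => z /F0RNN_pen.
Qed.

End BlockContinuity.

Section Minimizers.
Context {R : realType}.

Lemma mx_norm_le_enorm m n (A : 'M[R]_(m, n)) : `|A| <= enorm A.
Proof.
rewrite [leLHS]/Num.norm /= mx_normrE.
by apply: bigmax_le => // -[i j] _; exact: entry_le_enorm.
Qed.

(** A nonempty sublevel set is compact and contains a minimizer; the set of all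
minimizers is itself a sublevel set. *)
Lemma minimizers_compact n (D : set 'rV[R]_n) (f : 'rV[R]_n -> R) :
  closed D -> D !=set0 -> continuous f ->
  (forall K, exists M, forall z, D z -> f z <= K -> enorm z <= M) ->
  global_minimizers D f !=set0 /\ compact (global_minimizers D f).
Proof.
move=> Dcl [z0 Dz0] fc fM.
have subc K : compact (D `&` [set z | f z <= K]).
  apply: bounded_closed_compact.
    have [M HM] := fM K; exists M; split; first exact: num_real.
    move=> M' MM' z [Dz fz]; apply: (le_trans (mx_norm_le_enorm _)).
    exact: le_trans (HM _ Dz fz) (ltW MM').
  apply: closedI => //.
  by apply: (@preimage_closed _ _ f [set t | t <= K]) => // ; exact: closed_le.
have K0 : (D `&` [set z | f z <= f z0]) !=set0 by exists z0; split=> //; exact: lexx.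
have [c] := EVT_min_rV K0 (subc (f z0)) (continuous_subspaceT fc).
rewrite inE => -[Dc fcz0] cmin.
have cglob : global_minimizers D f c.
  split => // z Dz; have [fz|/ltW fz] := leP (f z) (f z0).
    by apply: cmin; rewrite inE.
  exact: le_trans fcz0 fz.
split; first by exists c.
rewrite (_ : global_minimizers D f = D `&` [set z | f z <= f c]) //.
apply/seteqP; split=> z [Dz Hz]; split=> //; first exact: Hz.
by move=> z' Dz'; apply: (le_trans Hz); apply: cglob.2.
Qed.

End Minimizers.

Section Sublevel.
Context {R : realType} {N0 N1 N2 : nat}.
Variables (lambda alpha : R) (x : 'I_3 -> 'cV[R]_N0) (y : 'I_3 -> 'cV[R]_N2).
Hypotheses (hlambda : 0 < lambda) (halpha : 0 <= alpha < 1).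
Notation point := ('rV[R]_(nz N0 N1 N2)).
Notation Theta := (@Theta R N0 N1 N2 lambda alpha x y).
Notation F := (@F R N0 N1 N2 lambda y).
Implicit Types (z d : point) (t : 'I_3).

Lemma sigma0 n : sigma alpha (0 : 'cV[R]_n) = 0.
Proof. by apply/matrixP => i j; rewrite !mxE mulr0 maxxx. Qed.

Lemma enorm_sigma_le n (w : 'cV[R]_n) : enorm (sigma alpha w) <= enorm w.
Proof. by have := sigma_nonexpansive halpha w 0; rewrite sigma0 !subr0. Qed.

(** The four terms of [Theta] are nonnegative, so each of them is at most [K]. *)
Lemma sublevel_theta beta1 beta2 z K : 0 < beta1 -> 0 < beta2 ->
  Theta beta1 beta2 z <= K ->
  [/\ enorm (z_theta z) <= Num.sqrt (K / lambda),
      enorm (z_rvec z - yvec y) <= Num.sqrt (6 * K),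
      pen1 alpha x z <= K / beta1 & pen2 alpha z <= K / beta2].
Proof.
move=> b1 b2; rewrite ThetaE /F => zK.
have p1 := mulr_ge0 (ltW b1) (pen1_ge0 alpha x z).
have p2 := mulr_ge0 (ltW b2) (pen2_ge0 alpha z).
have q1 := mulr_ge0 (ltW hlambda) (sqr_ge0 (enorm (z_theta z))).
have q2 := sqr_ge0 (enorm (z_rvec z - yvec y)).
split.
- rewrite -[leLHS]ger0_norm // -sqrtr_sqr ler_wsqrtr // ler_pdivlMr //; lra.
- rewrite -[leLHS]ger0_norm // -sqrtr_sqr ler_wsqrtr //; lra.
- rewrite ler_pdivlMr //; lra.
- rewrite ler_pdivlMr //; lra.
Qed.

(** Parameters and residuals are bounded on a sublevel set, and they bound the
states through the recursion; the offsets [A x_t + b] and [c] are counted among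
the errors, that is, the states are compared with zero. *)
Lemma Theta_sublevel_bounded beta1 beta2 : 0 < beta1 -> 0 < beta2 ->
  forall K, exists M, forall z, Theta beta1 beta2 z <= K -> enorm z <= M.
Proof.
move=> b1 b2 K; pose rho := Num.sqrt (K / lambda).
have rho0 : 0 <= rho by exact: sqrtr_ge0.
pose g := 1 + rho + rho ^+ 2.
pose X := K / beta1 + \sum_t (rho * enorm (x t) + rho).
pose Y := K / beta2 + \sum_(t < 3) rho.
pose M := g * X + (Y + rho * g * X).
exists (rho + 4 * M) => z.
move=> /(sublevel_theta b1 b2)[th _ p1 p2].
have rW := le_trans (enorm_W_le_theta z) th.
have rA := le_trans (enorm_A_le_theta z) th.
have rV := le_trans (enorm_V_le_theta z) th.
have rb := le_trans (enorm_b_le_theta z) th.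
have rc := le_trans (enorm_c_le_theta z) th.
have [] := @recursion_bound _ _ _ _ z rho
  (fun t => l1norm (res_w x z t) + (rho * enorm (x t) + rho))
  (fun t => l1norm (res_s alpha z t))
  (fun t => l1norm (res_v z t) + rho) (fun t => l1norm (res_r alpha z t)) rho0.
- by move=> t; rewrite addr_ge0 ?l1norm_ge0 // addr_ge0 // mulr_ge0.
- by move=> t; exact: l1norm_ge0.
- by move=> t; rewrite addr_ge0 ?l1norm_ge0.
- by move=> t; exact: l1norm_ge0.
- move=> t.
  have -> : z_w z t = res_w x z t + (z_A z *m x t + z_b z + z_W z *m z_sprev z t).
    by apply/matrixP => i j; rewrite !mxE; ring.
  rewrite -[leRHS]addrA.
  apply: le_trans (enormD _ _) (lerD (enorm_le_l1norm _) _).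
  apply: le_trans (enormD _ _) (lerD _ _); last first.
    by rewrite (le_trans (enormM _ _)) // ler_wpM2r.
  apply: le_trans (enormD _ _) (lerD _ rb).
  by rewrite (le_trans (enormM _ _)) // ler_wpM2r.
- move=> t.
  have -> : z_s z t = res_s alpha z t + sigma alpha (z_w z t).
    by rewrite /res_s subrK.
  rewrite (le_trans (enormD _ _)) // lerD ?enorm_le_l1norm //.
  exact: enorm_sigma_le.
- move=> t.
  have -> : z_v z t = res_v z t + (z_c z + z_V z *m z_s z t).
    by apply/matrixP => i j; rewrite !mxE; ring.
  rewrite -[leRHS]addrA.
  apply: le_trans (enormD _ _) (lerD (enorm_le_l1norm _) _).
  apply: le_trans (enormD _ _) (lerD rc _).
  by rewrite (le_trans (enormM _ _)) // ler_wpM2r.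
- move=> t.
  have -> : z_r z t = res_r alpha z t + sigma alpha (z_v z t).
    by rewrite /res_r subrK.
  rewrite (le_trans (enormD _ _)) // lerD ?enorm_le_l1norm //.
  exact: enorm_sigma_le.
set E1 := (\sum_t (_ + l1norm (res_s _ _ _))).
set E2 := (\sum_t (_ + l1norm (res_r _ _ _))); move=> _ bl.
have E1X : E1 <= X.
  rewrite /X (le_trans _ (lerD p1 (lexx _))) // /pen1 -big_split /=.
  by apply: ler_sum => t _; lra.
have E2Y : E2 <= Y.
  rewrite /Y (le_trans _ (lerD p2 (lexx _))) // /pen2 -big_split /=.
  by apply: ler_sum => t _; lra.
have E10 : 0 <= E1.
  apply: sumr_ge0 => t _; rewrite addr_ge0 ?l1norm_ge0 //.
  by rewrite addr_ge0 ?l1norm_ge0 // addr_ge0 // mulr_ge0.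
have E20 : 0 <= E2.
  by apply: sumr_ge0 => t _; rewrite addr_ge0 ?l1norm_ge0 // addr_ge0 ?l1norm_ge0.
have g0 : 0 <= g by rewrite /g !addr_ge0 // sqr_ge0.
have gX : g * E1 <= g * X by rewrite ler_wpM2l.
have gX0 : 0 <= g * X by rewrite mulr_ge0 // (le_trans E10).
have rgX : rho * g * E1 <= rho * g * X by rewrite ler_wpM2l // mulr_ge0.
have rgX0 : 0 <= rho * g * X by rewrite mulr_ge0 ?mulr_ge0 // (le_trans E10).
have Y0 := le_trans E20 E2Y.
have MM t : [/\ enorm (z_w z t) <= M, enorm (z_s z t) <= M,
    enorm (z_v z t) <= M & enorm (z_r z t) <= M].
  by have [h1 h2 h3 h4] := bl t; rewrite -/g in h1 h2 h3 h4; split; rewrite /M; lra.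
by rewrite (le_trans (enorm_le_blocks MM)) // lerD2r.
Qed.

Lemma F0RNN0 : F0RNN alpha x (0 : point).
Proof.
have z0 t : z_sprev (0 : point) t = 0.
  rewrite /z_sprev; case: (t : nat) => // k.
  by apply/matrixP => i j; rewrite !mxE.
move=> t; rewrite z0 mulmx0.
by split; apply/matrixP => i j; rewrite !mxE ?mulr0 ?maxxx // ?addr0 ?add0r //;
  rewrite big1 // => k _; rewrite !mxE ?mul0r ?mulr0.
Qed.

Lemma Theta0 beta1 beta2 : Theta beta1 beta2 0 = gamma_y y.
Proof.
have [p1 p2] := (F0RNN_pen _ _ _).1 F0RNN0.
rewrite ThetaE p1 p2 !mulr0 !addr0 /F /gamma_y.
have -> : z_rvec (0 : point) = 0 by apply/matrixP => i j; rewrite !mxE.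
have -> : z_theta (0 : point) = 0 by apply/matrixP => i j; rewrite !mxE.
by rewrite enorm0 add0r enormN expr0n mulr0 addr0.
Qed.

Lemma Theta_F0 beta1 beta2 z : F0RNN alpha x z -> Theta beta1 beta2 z = F z.
Proof. by move=> /F0RNN_pen[p1 p2]; rewrite ThetaE p1 p2 !mulr0 !addr0. Qed.

(** On the feasible set [F] agrees with [Theta] for any weights, here both [1]. *)
Lemma S0_nonempty_compact :
  (S0RNN lambda alpha x y : set point) !=set0 /\
  compact (S0RNN lambda alpha x y : set point).
Proof.
apply: minimizers_compact.
- exact: closed_F0RNN.
- by exists 0; exact: F0RNN0.
- exact: continuous_F.
- move=> K; have [M HM] := Theta_sublevel_bounded ltr01 ltr01 K.
  by exists M => z Dz FK; apply: HM; rewrite Theta_F0.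
Qed.

Lemma S1_nonempty_compact beta1 beta2 : 0 < beta1 -> 0 < beta2 ->
  (S1RNN lambda alpha x y beta1 beta2 : set point) !=set0 /\
  compact (S1RNN lambda alpha x y beta1 beta2 : set point).
Proof.
move=> b1 b2; apply: minimizers_compact.
- exact: closedT.
- by exists 0.
- exact: continuous_Theta.
- move=> K; have [M HM] := Theta_sublevel_bounded b1 b2 K.
  by exists M => z _; exact: HM.
Qed.

End Sublevel.

(** * Local minimizers *)

Section QuadraticDerivatives.
Context {R : realType}.

(** The two-sided difference quotient is [a + h * b]. *)
Lemma derive_quadratic n (f : 'rV[R]_n -> R) x v (a b : R) :
  (forall h : R, f (x + h *: v) = f x + h * a + h ^+ 2 * b) -> 'D_v f x = a.
Proof.
move=> fE; apply: cvg_lim => //.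
have H : (a + h * b) @[h --> (0 : R)^'] --> a.
  rewrite -[X in _ --> X]addr0 -[X in _ --> _ + X](mul0r b).
  apply: cvgD; first exact: cvg_cst.
  apply: cvgMr_tmp; apply: cvg_within_filter; exact: cvg_id.
apply: cvg_trans H; apply: near_eq_cvg; near=> h.
have h0 : h != 0 by near: h; exact: nbhs_dnbhs_neq.
rewrite /= [h *: v + _]addrC fE /GRing.scale /=.
by field.
Unshelve. all: by end_near. Qed.

Lemma linear_coord n (L : 'rV[R]_n -> R) (d : 'rV[R]_n) :
  (forall a u v, L (a *: u + v) = a * L u + L v) ->
  L d = \sum_i L (delta_mx 0 i) * d 0 i.
Proof.
move=> Llin; have L0 : L 0 = 0.
  by have := Llin 1 0 0; rewrite scale1r addr0 mul1r; lra.
rewrite [in LHS](row_sum_delta d).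
elim/big_rec2 : _ => // i u v _ <-.
by rewrite Llin mulrC.
Qed.

Lemma near_right_seq (P : R -> Prop) (tau : nat -> R) :
  (forall k, 0 < tau k) -> tau k @[k --> \oo] --> (0 : R) ->
  (\forall t \near 0^'+, P t) -> \forall k \near \oo, P (tau k).
Proof.
move=> tau0 tauc PE; have := tauc _ PE; rewrite /nbhs /= /fmap /=.
by apply: filterS => k; apply.
Qed.

(** Division by [tau] leaves [0 <= q + tau * c] for small [tau]: a negative [q]
would dominate. *)
Lemma local_min_ray (U : normedModType R) (f : U -> R) z d q c :
  local_minimizer setT f z ->
  (\forall tau \near 0^'+, f (z + tau *: d) = f z + tau * q + tau ^+ 2 * c) ->
  0 <= q /\ (q = 0 -> 0 <= c).
Proof.
move=> [_ zmin] fE.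
have zc : z + tau *: d @[tau --> 0^'+] --> z.
  rewrite -[X in _ --> X]addr0 -[X in _ --> _ + X](scale0r d).
  apply: cvgD; first exact: cvg_cst.
  by apply: cvgZr_tmp; apply: cvg_at_right_filter; exact: cvg_id.
have zmin' : \forall tau \near 0^'+, setT (z + tau *: d) -> f z <= f (z + tau *: d).
  exact: zc _ zmin.
have fge : \forall tau \near 0^'+, 0 <= q + tau * c.
  near=> tau; have t0 : 0 < tau by near: tau; exact: nbhs_right_gt.
  have : f z <= f (z + tau *: d) by apply: (near zmin' tau).
  rewrite (near fE tau) // -addrA lerDl expr2 -mulrA -mulrDr pmulr_rge0 //.
split.
  rewrite leNgt; apply/negP => q0.
  have h : \forall tau \near 0^'+, 0 <= (- q / 2) + tau * (- c) + tau ^+ 2 * 0.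
    by apply: ray_ge0; rewrite divr_gt0 // oppr_gt0.
  near (0 : R)^'+ => tau.
  have : 0 <= q + tau * c by near: tau.
  have : 0 <= (- q / 2) + tau * (- c) + tau ^+ 2 * 0 by near: tau.
  by rewrite mulr0; lra.
move=> q0; near (0 : R)^'+ => tau.
have t0 : 0 < tau by near: tau; exact: nbhs_right_gt.
have : 0 <= q + tau * c by near: tau.
by rewrite q0 add0r pmulr_rge0.
Unshelve. all: by end_near. Qed.

End QuadraticDerivatives.

Section LocalMinimizers.
Context {R : realType} {N0 N1 N2 : nat}.
Variables (lambda alpha : R) (x : 'I_3 -> 'cV[R]_N0) (y : 'I_3 -> 'cV[R]_N2).
Hypotheses (hlambda : 0 < lambda) (halpha : 0 <= alpha < 1).
Notation point := ('rV[R]_(nz N0 N1 N2)).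
Notation Theta := (@Theta R N0 N1 N2 lambda alpha x y).
Notation F := (@F R N0 N1 N2 lambda y).
Notation F0 := (F0RNN alpha x : set point).
Notation dF := (dF lambda y).
Notation Q := (hessF lambda).
Implicit Types (z d : point) (t : 'I_3).

Lemma derive_F z d : 'D_d F z = dF z d.
Proof. by apply: derive_quadratic => h; exact: F_ray. Qed.

Lemma gradient_F z d : dotp (gradient F z) d = dF z d.
Proof.
rewrite [RHS]linear_coord; last exact: dF_linear.
by rewrite /dotp mxE; apply: eq_bigr => i _; rewrite !mxE derive_F.
Qed.

Lemma hessFC d d' : Q d d' = Q d' d.
Proof. by rewrite /hessF mxdotC (mxdotC (z_theta d)). Qed.

Lemma hessF_linear d (a : R) u v : Q d (a *: u + v) = a * Q d u + Q d v.
Proof.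
rewrite /hessF [a *: u + v]addrC !z_linE !(mxdotDr, mxdotZr); ring.
Qed.

Lemma hessian_F z d : dotp (d *m hessian F z) d = Q d d.
Proof.
rewrite [RHS]linear_coord; last exact: hessF_linear.
rewrite /dotp mxE; apply: eq_bigr => j _; rewrite !mxE; congr (_ * _).
rewrite hessFC [RHS]linear_coord; last exact: hessF_linear.
apply: eq_bigr => i _; rewrite !mxE mulrC; congr (_ * _).
rewrite hessFC (_ : (fun z' => _) = fun z' => dF z' (delta_mx 0 j)); last first.
  by apply/funext => z'; exact: derive_F.
by apply: (@derive_quadratic _ _ _ _ _ _ 0) => h; rewrite dF_ray mulr0 addr0.
Qed.

(** A tangent direction is a limit of feasible secants, along which [F] does not
decrease from a local minimizer; the quadratic term of the expansion of [F]
vanishes in the limit. *)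
Lemma local_min_tangent z d : local_minimizer F0 F z ->
  tangent_cone F0 z d -> 0 <= dF z d.
Proof.
move=> [_ zmin] [xk [tau [xF xz tau0 tauc qd]]].
pose q k := (tau k)^-1 *: (xk k - z).
have xE k : xk k = z + tau k *: q k.
  by rewrite /q scalerA mulfV ?gt_eqF // scale1r addrC subrK.
have lim : dF z (q k) + tau k * (Q (q k) (q k) / 2) @[k --> \oo] -->
    dF z d + 0 * (Q d d / 2).
  apply: cvgD.
    exact: (@cvg_comp _ _ _ q (dF z) _ _ _ qd (@continuous_dF _ _ _ _ _ _ z d)).
  apply: cvgM => //; apply: cvgMr_tmp.
  exact: (@cvg_comp _ _ _ q (fun d => Q d d) _ _ _ qd (@continuous_hessF _ _ _ _ _ d)).
rewrite mul0r addr0 in lim.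
apply: (cvgr_to_ge lim); near=> k.
have : F z <= F (xk k).
  have : F0 (xk k) -> F z <= F (xk k) by near: k; exact: xz _ zmin.
  by apply.
rewrite xE F_ray -addrA lerDl expr2 -mulrA -mulrDr pmulr_rge0 //.
Unshelve. all: by end_near. Qed.

Lemma local_min_second_order_P0 z :
  local_minimizer F0 F z -> second_order_d_stationary F0 F z.
Proof.
move=> zmin; split; first exact: zmin.1.
  by move=> d zd; rewrite gradient_F; exact: local_min_tangent zd.
by move=> d _ _; rewrite hessian_F hessF_ge0.
Qed.

(** The derivatives along rays are known explicitly, which turns stationarity
into an inequality without limits. *)
Lemma d_stationary_free_Theta beta1 beta2 z :
  d_stationary_free (Theta beta1 beta2) z <->
  forall d, 0 <= dTheta lambda alpha x y beta1 beta2 z d.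
Proof.
split=> H d.
  have [_ <- _] := ray2_dderiv (Theta_ray2 lambda x y halpha beta1 beta2 z d).
  exact: (H d).2.
by have [? -> _] := ray2_dderiv (Theta_ray2 lambda x y halpha beta1 beta2 z d).
Qed.

Lemma d_stationary_F0 z : d_stationary F0 F z <->
  F0 z /\ forall d, tangent_cone F0 z d -> 0 <= dF z d.
Proof.
have FE d := ray2_dderiv (F_ray2 lambda y z d).
split=> -[Dz H]; split=> // d /H; have [? Ed _] := FE d.
  by rewrite Ed => -[].
by rewrite Ed.
Qed.

Lemma local_min_second_order_P1 beta1 beta2 z :
  local_minimizer setT (Theta beta1 beta2) z ->
  second_order_d_stationary_free (Theta beta1 beta2) z.
Proof.
move=> zmin; split=> d; have [dd -> [c [cE [d2 d2E]]]] :=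
  ray2_dderiv (Theta_ray2 lambda x y halpha beta1 beta2 z d).
  by have [? _] := local_min_ray zmin cE.
move=> q0; split=> //; rewrite d2E mulr_ge0 //.
by have [_] := local_min_ray zmin cE; apply.
Qed.

End LocalMinimizers.

(** * The tangent and radial cones of the feasible set *)

Section Cones.
Context {R : realType} {N0 N1 N2 : nat}.
Notation point := ('rV[R]_(nz N0 N1 N2)).
Implicit Types (z d : point) (t : 'I_3).

(** The exact solution [d'] of a network-like recursion with the parameters of
[d] differs from [d] by a quantity [d' - d] that satisfies the scalar recursion
of [recursion_bound], the defects of [d] in the equations being the errors. *)
Lemma perturbed_recursion (rho : R) (V : 'M[R]_(N2, N1)) (W : 'M[R]_N1)
    (a : 'I_3 -> 'cV[R]_N1) (c : 'I_3 -> 'cV[R]_N2)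
    (phi : 'I_3 -> 'cV[R]_N1 -> 'cV[R]_N1) (psi : 'I_3 -> 'cV[R]_N2 -> 'cV[R]_N2)
    d :
  enorm V <= rho -> enorm W <= rho ->
  (forall t u v, enorm (phi t u - phi t v) <= enorm (u - v)) ->
  (forall t u v, enorm (psi t u - psi t v) <= enorm (u - v)) ->
  let E1 := \sum_t (l1norm (z_w d t - (W *m z_sprev d t + a t)) +
                    l1norm (z_s d t - phi t (z_w d t))) in
  let E2 := \sum_t (l1norm (z_v d t - (V *m z_s d t + c t)) +
                    l1norm (z_r d t - psi t (z_v d t))) in
  let g := 1 + rho + rho ^+ 2 in
  exists d' : point, [/\ z_theta d' = z_theta d,
    (forall t, [/\ z_w d' t = W *m z_sprev d' t + a t,
                  z_s d' t = phi t (z_w d' t),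
                  z_v d' t = V *m z_s d' t + c t &
                  z_r d' t = psi t (z_v d' t)]),
    \sum_t enorm (z_r d' t - z_r d t) <= E2 + rho * g * E1 &
    enorm (d' - d) <= 4 * (g * E1 + (E2 + rho * g * E1))].
Proof.
move=> Vr Wr phi1 psi1 E1 E2 g.
have rho0 : 0 <= rho by exact: le_trans Vr.
have [d' [dth dE]] := unroll_exists (z_theta d)
  (fun t s => W *m s + a t) phi (fun t s => V *m s + c t) psi.
exists d'; pose e := d' + (-1) *: d.
have eE : d' - d = e by rewrite /e scaleN1r.
have [] := @recursion_bound _ _ _ _ e rho
  (fun t => l1norm (z_w d t - (W *m z_sprev d t + a t)))
  (fun t => l1norm (z_s d t - phi t (z_w d t)))
  (fun t => l1norm (z_v d t - (V *m z_s d t + c t)))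
  (fun t => l1norm (z_r d t - psi t (z_v d t))) rho0; try by move=> t; exact: l1norm_ge0.
- move=> t; have [h _ _ _] := dE t; rewrite !z_linE {1}h.
  rewrite [X in enorm X](_ : _ = - (z_w d t - (W *m z_sprev d t + a t)) +
      W *m (z_sprev d' t + -1 *: z_sprev d t)); last first.
    rewrite mulmxDr -scalemxAr; apply/matrixP => i j; rewrite !mxE; ring.
  apply: le_trans (enormD _ _) (lerD _ _).
    by rewrite enormN enorm_le_l1norm.
  by rewrite (le_trans (enormM _ _)) // ler_wpM2r.
- move=> t; have [_ h _ _] := dE t; rewrite !z_linE {1}h.
  rewrite [X in enorm X](_ : _ = - (z_s d t - phi t (z_w d t)) +
      (phi t (z_w d' t) - phi t (z_w d t))); last first.
    by apply/matrixP => i j; rewrite !mxE; ring.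
  apply: le_trans (enormD _ _) (lerD _ _).
    by rewrite enormN enorm_le_l1norm.
  by rewrite scaleN1r.
- move=> t; have [_ _ h _] := dE t; rewrite !z_linE {1}h.
  rewrite [X in enorm X](_ : _ = - (z_v d t - (V *m z_s d t + c t)) +
      V *m (z_s d' t + -1 *: z_s d t)); last first.
    rewrite mulmxDr -scalemxAr; apply/matrixP => i j; rewrite !mxE; ring.
  apply: le_trans (enormD _ _) (lerD _ _).
    by rewrite enormN enorm_le_l1norm.
  by rewrite (le_trans (enormM _ _)) // ler_wpM2r.
- move=> t; have [_ _ _ h] := dE t; rewrite !z_linE {1}h.
  rewrite [X in enorm X](_ : _ = - (z_r d t - psi t (z_v d t)) +
      (psi t (z_v d' t) - psi t (z_v d t))); last first.
    by apply/matrixP => i j; rewrite !mxE; ring.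
  apply: le_trans (enormD _ _) (lerD _ _).
    by rewrite enormN enorm_le_l1norm.
  by rewrite scaleN1r.
rewrite -/E1 -/E2 -/g => sumr bl; split=> //.
  by apply: le_trans sumr; apply: ler_sum => t _; rewrite z_linE scaleN1r.
have E10 : 0 <= E1 by apply: sumr_ge0 => t _; rewrite addr_ge0 ?l1norm_ge0.
have E20 : 0 <= E2 by apply: sumr_ge0 => t _; rewrite addr_ge0 ?l1norm_ge0.
have gE0 : 0 <= g * E1.
  by rewrite mulr_ge0 // /g !addr_ge0 // sqr_ge0.
have rgE0 : 0 <= rho * g * E1 by rewrite -mulrA mulr_ge0.
rewrite eE (le_trans (@enorm_le_blocks _ _ _ _ e (g * E1 + (E2 + rho * g * E1)) _)) //.
  by move=> t; have [h1 h2 h3 h4] := bl t; split; lra.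
by rewrite z_linE dth scaleN1r subrr enorm0 add0r.
Qed.

Variables (alpha : R) (x : 'I_3 -> 'cV[R]_N0).
Hypothesis halpha : 0 <= alpha < 1.
Notation F0 := (F0RNN alpha x : set point).

(** The network is run with the parameters of [z]: its states differ from those
of [z] by a multiple of the residuals. *)
Lemma feasible_error_bound (rho : R) z : enorm (z_theta z) <= rho ->
  exists z', [/\ F0 z', z_theta z' = z_theta z & enorm (z' - z) <=
    4 * ((1 + rho) * (1 + rho + rho ^+ 2)) * (pen1 alpha x z + pen2 alpha z)].
Proof.
move=> zr; have rho0 : 0 <= rho by exact: le_trans zr.
have [z' [zth zE _ zz]] := @perturbed_recursion rho (z_V z) (z_W z)
  (fun t => z_A z *m x t + z_b z) (fun=> z_c z) (fun=> @sigma _ alpha _)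
  (fun=> @sigma _ alpha _) z (le_trans (enorm_V_le_theta z) zr)
  (le_trans (enorm_W_le_theta z) zr) (fun=> @sigma_nonexpansive _ _ halpha _)
  (fun=> @sigma_nonexpansive _ _ halpha _).
exists z'; split=> //.
  have [AE VE WE bE cE] := eq_theta_blocks zth.
  move=> t; have [h1 h2 h3 h4] := zE t.
  by rewrite AE VE WE bE cE -addrA.
apply: (le_trans zz).
set E1 := \sum_t _; set E2 := \sum_t _.
have <- : E1 = pen1 alpha x z.
  apply: eq_bigr => t _; congr (l1norm _ + _).
  by rewrite /res_w !opprD !addrA.
have <- : E2 = pen2 alpha z.
  apply: eq_bigr => t _; congr (l1norm _ + _).
  by rewrite /res_v opprD addrA.
have E10 : 0 <= E1 by apply: sumr_ge0 => t _; rewrite addr_ge0 ?l1norm_ge0.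
have E20 : 0 <= E2 by apply: sumr_ge0 => t _; rewrite addr_ge0 ?l1norm_ge0.
have h1 : 0 <= rho * E2 by rewrite mulr_ge0.
have h2 : 0 <= rho * (rho * E2) by rewrite !mulr_ge0.
have h3 : 0 <= rho * (rho * (rho * E2)) by rewrite !mulr_ge0.
have h4 : 0 <= rho * E1 by rewrite mulr_ge0.
have h5 : 0 <= rho * (rho * E1) by rewrite !mulr_ge0.
have h6 : 0 <= rho * (rho * (rho * E1)) by rewrite !mulr_ge0.
rewrite -subr_ge0 [leRHS](_ : _ = 8 * (rho * E2) + 8 * (rho * (rho * E2)) +
  4 * (rho * (rho * (rho * E2)))); last by ring.
by rewrite !addr_ge0 // mulr_ge0.
Qed.

(** The penalties of [z + tau *: d] are of order [tau ^+ 2], hence so is the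
distance to a feasible point: dividing by [tau], the secants tend to [d]. *)
Lemma tangent_formula_subset z : F0 z ->
  tangent_formula alpha x z `<=` tangent_cone F0 z.
Proof.
move=> Fz d /(tangent_formula_lin x halpha) lin0.
have res0 := (F0RNN_res _ _ _).1 Fz.
have pen2E : exists c, \forall tau \near 0^'+,
    pen1 alpha x (z + tau *: d) + pen2 alpha (z + tau *: d) = tau ^+ 2 * c.
  have := ray2D (pen1_ray2 x halpha z d) (pen2_ray2 halpha z d).
  have [p1 p2] := (F0RNN_pen _ _ _).1 Fz.
  have -> : dpen1 alpha x z d = 0.
    apply: big1 => t _; have [-> -> _ _] := lin0 t; have [-> -> _ _] := res0 t.
    by rewrite !dl1norm0 !l1norm0 addr0.
  have -> : dpen2 alpha z d = 0.
    apply: big1 => t _; have [_ _ -> ->] := lin0 t; have [_ _ -> ->] := res0 t.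
    by rewrite !dl1norm0 !l1norm0 addr0.
  move=> [c cE]; exists c; near=> tau.
  by rewrite (near cE tau) // p1 p2 !addr0 mulr0 !add0r.
have [c cE] := pen2E.
pose tau (k : nat) : R := k.+1%:R^-1.
have tau0 k : 0 < tau k by rewrite invr_gt0.
have tau1 k : tau k <= 1 by rewrite invf_le1 // ler1n.
have tauc : tau k @[k --> \oo] --> (0 : R) by exact: cvg_harmonic.
have cE' := near_right_seq tau0 tauc cE.
pose rho := enorm (z_theta z) + enorm (z_theta d).
have rhoE k : enorm (z_theta (z + tau k *: d)) <= rho.
  rewrite z_linE (le_trans (enormD _ _)) // lerD2l enormZ gtr0_norm //.
  by rewrite ler_piMl.
have [xk xkE] := choice (fun k => feasible_error_bound (rhoE k)).
pose C := 4 * ((1 + rho) * (1 + rho + rho ^+ 2)).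
pose q k := (tau k)^-1 *: (xk k - z).
have qd : q k @[k --> \oo] --> d.
  have h : (fun k => `|q k - d|) @ \oo --> (0 : R).
    apply: (@squeeze_cvgr _ _ _ _ (fun=> 0) (fun k => tau k * (C * c))).
    - near=> k; rewrite normr_ge0 /= (le_trans (mx_norm_le_enorm _)) //.
      have -> : q k - d = (tau k)^-1 *: (xk k - (z + tau k *: d)).
        by rewrite opprD addrA scalerBr [in RHS]scalerA mulVf ?gt_eqF // scale1r.
      rewrite enormZ gtr0_norm ?invr_gt0 // ler_pdivrMl //.
      have [_ _] := xkE k; move=> /le_trans; apply.
      have -> : pen1 alpha x (z + tau k *: d) + pen2 alpha (z + tau k *: d) =
          tau k ^+ 2 * c by exact: (near cE' k).
      by rewrite -/C mulrCA expr2 -mulrA.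
    - exact: cvg_cst.
    - by rewrite -(mul0r (C * c)); exact: cvgMr_tmp.
  by apply/subr_cvg0/norm_cvg0P.
exists xk, tau; split=> //.
  by move=> k; have [] := xkE k.
have -> : xk = (fun k => z + tau k *: q k).
  by apply/funext => k; rewrite /q scalerA mulfV ?gt_eqF // scale1r addrC subrK.
rewrite -[X in _ --> X]addr0 -[X in _ --> _ + X](scale0r d).
by apply: cvgD; [exact: cvg_cst|exact: cvgZ].
Unshelve. all: by end_near. Qed.

Lemma mcont_lin_w z t : mcont (fun d => lin_w x z d t).
Proof.
apply: mcontD (@mcont_w _ _ _ _ t) (mcontN _).
apply: mcontD _ mcont_b; apply: mcontD _ (mcontM mcont_A (mcont_cst _)).
apply: mcontD (mcontM mcont_W (mcont_cst _)) _.
exact: mcontM (mcont_cst _) (@mcont_sprev _ _ _ _ t).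
Qed.

Lemma mcont_lin_v z t : mcont (fun d => lin_v z d t).
Proof.
apply: mcontD (@mcont_v _ _ _ _ t) (mcontN _).
apply: mcontD _ mcont_c.
apply: mcontD (mcontM mcont_V (mcont_cst _)) _.
exact: mcontM (mcont_cst _) (@mcont_s _ _ _ _ t).
Qed.

Lemma mcont_cvg m n (f : point -> 'M[R]_(m, n)) (q : nat -> point) d i j :
  mcont f -> q @ \oo --> d -> f (q k) i j @[k --> \oo] --> f d i j.
Proof.
move=> fc qd; exact: (@cvg_comp _ _ _ q (fun d => f d i j) _ _ _ qd (fc i j d)).
Qed.

(** The equation [g = sigma f] is compared along the secants with the exact
one-sided expansion of [sigma] in direction [d]: as [sigma] is nonexpansive,
the error is at most the distance between the secants of [f] and their limit. *)
Lemma secant_sigma n (f g : point -> 'cV[R]_n) (tau : nat -> R)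
    (q : nat -> point) z d :
  mcont f -> mcont g ->
  (forall a d', f (z + a *: d') = f z + a *: f d') ->
  (forall a d', g (z + a *: d') = g z + a *: g d') ->
  (forall k, 0 < tau k) -> tau k @[k --> \oo] --> (0 : R) ->
  q @ \oo --> d -> g z = sigma alpha (f z) ->
  (forall k, g (z + tau k *: q k) = sigma alpha (f (z + tau k *: q k))) ->
  g d = dsigma alpha (f z) (f d).
Proof.
move=> fc gc fP gP tau0 tauc qd gz gE; apply/matrixP => i j.
have fq : f (q k) i j - f d i j @[k --> \oo] --> 0.
  by apply/subr_cvg0; exact: mcont_cvg.
have gq : g (q k) i j - dsigma alpha (f z) (f d) i j @[k --> \oo] -->
    g d i j - dsigma alpha (f z) (f d) i j.
  by apply: cvgB; [exact: mcont_cvg|exact: cvg_cst].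
have sE := near_right_seq tau0 tauc (sigma_ray halpha (f z) (f d)).
apply/eqP; rewrite -subr_eq0 -normr_le0.
have fq0 : `|f (q k) i j - f d i j| @[k --> \oo] --> (0 : R).
  by rewrite -(normr0 R); exact: cvg_norm fq.
have gq0 : `|g (q k) i j - dsigma alpha (f z) (f d) i j| @[k --> \oo] -->
    `|g d i j - dsigma alpha (f z) (f d) i j| by exact: cvg_norm gq.
apply: (ler_cvg_to gq0 fq0); near=> k.
have tk := tau0 k.
have ge := congr1 (fun M : 'cV[R]_n => M i j) (gE k).
have sd : sigma alpha (f z + tau k *: f d) =
  sigma alpha (f z) + tau k *: dsigma alpha (f z) (f d) by exact: (near sE k).
have {}sd := congr1 (fun M : 'cV[R]_n => M i j) sd.
rewrite fP gP gz !mxE in ge; rewrite !mxE in sd; rewrite mxE.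
have := lrelu_lipschitz halpha (f z i j + tau k * f (q k) i j)
  (f z i j + tau k * f d i j).
rewrite sd -ge.
have cancel (p u v : R) : p + tau k * u - (p + tau k * v) = tau k * (u - v).
  by ring.
by rewrite !cancel !normrM gtr0_norm // ler_pM2l.
Unshelve. all: by end_near. Qed.

(** Along secants the affine equations leave [lin - tau *: product = 0], where the
product stays bounded. *)
Lemma tangent_cone_subset z : F0 z ->
  tangent_cone F0 z `<=` tangent_formula alpha x z.
Proof.
move=> Fz d [xk [tau [xF xz tau0 tauc qd]]].
pose q k := (tau k)^-1 *: (xk k - z).
have xE k : xk k = z + tau k *: q k.
  by rewrite /q scalerA mulfV ?gt_eqF // scale1r addrC subrK.
have res0 := (F0RNN_res _ _ _).1 Fz.
have resk k := (F0RNN_res _ _ _).1 (xF k).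
apply/(tangent_formula_lin x halpha) => t.
have [rw0 rs0 rv0 rr0] := res0 t.
have lim0 m (f g : point -> 'cV[R]_m) : mcont f -> mcont g ->
    (forall k, tau k *: f (q k) - tau k ^+ 2 *: g (q k) = 0) -> f d = 0.
  move=> fc gc fg; apply/matrixP => i j; rewrite mxE.
  have h1 := mcont_cvg (i := i) (j := j) fc qd.
  have h2 : tau k * g (q k) i j @[k --> \oo] --> 0 * g d i j.
    by apply: cvgM => //; exact: mcont_cvg.
  rewrite mul0r in h2; suff E : (fun k => f (q k) i j) = fun k => tau k * g (q k) i j.
    by rewrite E in h1; exact: (cvg_unique _ h1 h2).
  apply/funext => k; have /matrixP/(_ i j) := fg k; rewrite !mxE.
  have tk : tau k != 0 by rewrite gt_eqF.
  move/eqP; rewrite subr_eq0 expr2 -mulrA => /eqP; exact: mulfI.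
split.
- apply: (lim0 _ (fun d => lin_w x z d t) (fun d => z_W d *m z_sprev d t)); first exact: mcont_lin_w.
    exact: (mcontM mcont_W (@mcont_sprev _ _ _ _ t)).
  move=> k; have [h _ _ _] := resk k t.
  by move: h; rewrite xE res_w_ray rw0 add0r.
- apply/eqP; rewrite subr_eq0; apply/eqP.
  apply: (@secant_sigma _ (fun z => z_w z t) (fun z => z_s z t) tau q z) => //.
  + exact: mcont_w.
  + exact: mcont_s.
  + by move=> a d'; rewrite z_linE.
  + by move=> a d'; rewrite z_linE.
  + by have [_ h _ _] := Fz t.
  + by move=> k; rewrite -xE; have [_ h _ _] := xF k t.
- apply: (lim0 _ (fun d => lin_v z d t) (fun d => z_V d *m z_s d t)); first exact: mcont_lin_v.
    exact: (mcontM mcont_V (@mcont_s _ _ _ _ t)).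
  move=> k; have [_ _ h _] := resk k t.
  by move: h; rewrite xE res_v_ray rv0 add0r.
- apply/eqP; rewrite subr_eq0; apply/eqP.
  apply: (@secant_sigma _ (fun z => z_v z t) (fun z => z_r z t) tau q z) => //.
  + exact: mcont_v.
  + exact: mcont_r.
  + by move=> a d'; rewrite z_linE.
  + by move=> a d'; rewrite z_linE.
  + by have [_ _ _ h] := Fz t.
  + by move=> k; rewrite -xE; have [_ _ _ h] := xF k t.
Qed.

Lemma tangent_coneE z : F0 z -> tangent_cone F0 z = tangent_formula alpha x z.
Proof.
move=> Fz; apply/seteqP; split; first exact: tangent_cone_subset.
exact: tangent_formula_subset.
Qed.

Lemma radial_tangent z : radial_cone F0 z `<=` tangent_cone F0 z.
Proof.
move=> d [tau [tau0 tauc zF]].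
exists (fun k => z + tau k *: d), tau; split=> //.
  rewrite -[X in _ --> X]addr0 -[X in _ --> _ + X](scale0r d).
  by apply: cvgD; [exact: cvg_cst|exact: cvgZr_tmp].
rewrite (_ : (fun k => _) = fun=> d); first exact: cvg_cst.
apply/funext => k.
by rewrite addrC addKr scalerA mulVf ?gt_eqF // scale1r.
Qed.

(** On a ray in a tangent direction, the residuals of the activations vanish for
small [tau] and those of the affine maps are exactly [tau ^+ 2] times the two
products. *)
Lemma radial_coneE z : F0 z -> radial_cone F0 z =
  [set d | tangent_cone F0 z d /\
     forall t : 'I_3, z_V d *m z_s d t = 0 /\ z_W d *m z_sprev d t = 0].
Proof.
move=> Fz; have res0 := (F0RNN_res _ _ _).1 Fz; apply/seteqP; split=> d.
  move=> dR; have dT := radial_tangent dR; split=> // t.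
  have [tau [tau0 _ zF]] := dR.
  have [lw _ lv _] := (tangent_formula_lin x halpha _ _).1
    (tangent_cone_subset Fz dT) t.
  have [rw _ rv _] := (F0RNN_res _ _ _).1 (zF 0%N) t.
  have [rw0 _ rv0 _] := res0 t.
  have t0 : tau 0%N ^+ 2 != 0 by rewrite expf_neq0 // gt_eqF.
  move: rw rv; rewrite res_w_ray res_v_ray rw0 rv0 lw lv !scaler0 !addr0 !add0r.
  move=> /eqP; rewrite oppr_eq0 scaler_eq0 (negPf t0) => /eqP ->.
  by move=> /eqP; rewrite oppr_eq0 scaler_eq0 (negPf t0) => /eqP ->.
move=> [dT WV0].
have lin0 := (tangent_formula_lin x halpha _ _).1 (tangent_cone_subset Fz dT).
have : \forall tau \near 0^'+, forall t,
    res_s alpha (z + tau *: d) t = 0 /\ res_r alpha (z + tau *: d) t = 0.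
  apply: filter_forall => t; near=> tau.
  have [_ ls _ lr] := lin0 t; have [_ rs _ rr] := res0 t.
  split.
    rewrite (_ : res_s _ _ _ = res_s alpha z t + tau *: lin_s alpha z d t).
      by rewrite rs ls scaler0 addr0.
    by near: tau; exact: res_s_ray.
  rewrite (_ : res_r _ _ _ = res_r alpha z t + tau *: lin_r alpha z d t).
    by rewrite rr lr scaler0 addr0.
  by near: tau; exact: res_r_ray.
move=> sr0.
have [e /= e0 eF] : \forall tau \near 0^'+, F0 (z + tau *: d).
  near=> tau; apply/F0RNN_res => t.
  have [lw _ lv _] := lin0 t; have [rw _ rv _] := res0 t.
  have [V0 W0] := WV0 t.
  have [-> ->] : res_s alpha (z + tau *: d) t = 0 /\
    res_r alpha (z + tau *: d) t = 0 by move: t {lw lv rw rv V0 W0}; near: tau.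
  by rewrite res_w_ray res_v_ray rw rv lw lv V0 W0 !scaler0 !addr0 !subr0.
exists (fun k => e / 2 / k.+1%:R); split.
- by move=> k; rewrite !divr_gt0.
- by rewrite -(mulr0 (e / 2)); apply: cvgMl_tmp; exact: cvg_harmonic.
- move=> k; apply: eF; last by rewrite !divr_gt0.
  rewrite /= sub0r normrN gtr0_norm ?divr_gt0 //.
  apply: (@le_lt_trans _ _ (e / 2)); last by lra.
  by rewrite ler_pdivrMr // ler_peMr ?ler1n // divr_ge0 // ltW.
Unshelve. all: by end_near. Qed.

End Cones.

(** * Exactness of the penalty *)

Section ExactPenalty.
Context {R : realType} {N0 N1 N2 : nat}.
Variables (lambda alpha : R) (x : 'I_3 -> 'cV[R]_N0) (y : 'I_3 -> 'cV[R]_N2).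
Hypotheses (hlambda : 0 < lambda) (halpha : 0 <= alpha < 1).
Notation point := ('rV[R]_(nz N0 N1 N2)).
Notation Theta := (@Theta R N0 N1 N2 lambda alpha x y).
Notation F := (@F R N0 N1 N2 lambda y).
Notation F0 := (F0RNN alpha x : set point).
Notation gamma := (gamma_y y).
Implicit Types (z d : point) (t : 'I_3).

Lemma lin_zero_direction z t : [/\ lin_w x z 0 t = 0, lin_s alpha z 0 t = 0,
  lin_v z 0 t = 0 & lin_r alpha z 0 t = 0].
Proof.
have dsigma0 n (w : 'cV[R]_n) : dsigma alpha w 0 = 0.
  apply/matrixP => i j; rewrite !mxE /dlrelu mulr0 maxxx.
  by case: ifP => // _; case: ifP.
have -> : lin_w x z 0 t = 0.
  rewrite /lin_w [z_sprev 0 t](_ : _ = 0); last first.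
    rewrite /z_sprev; case: (t : nat) => // k.
    by apply/matrixP => i j; rewrite !mxE.
  rewrite [z_w 0 t](_ : _ = 0); last by apply/matrixP => i j; rewrite !mxE.
  rewrite [z_W 0](_ : _ = 0); last by apply/matrixP => i j; rewrite !mxE.
  rewrite [z_A 0](_ : _ = 0); last by apply/matrixP => i j; rewrite !mxE.
  rewrite [z_b 0](_ : _ = 0); last by apply/matrixP => i j; rewrite !mxE.
  by rewrite !mul0mx mulmx0 !addr0 subrr.
have s0 : z_s (0 : point) t = 0 by apply/matrixP => i j; rewrite !mxE.
have w0 : z_w (0 : point) t = 0 by apply/matrixP => i j; rewrite !mxE.
have v0 : z_v (0 : point) t = 0 by apply/matrixP => i j; rewrite !mxE.
have r0 : z_r (0 : point) t = 0 by apply/matrixP => i j; rewrite !mxE.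
rewrite /lin_s /lin_v /lin_r s0 w0 v0 r0 !dsigma0 mulmx0 !subr0; split=> //.
rewrite [z_V 0](_ : _ = 0); last by apply/matrixP => i j; rewrite !mxE.
rewrite [z_c 0](_ : _ = 0); last by apply/matrixP => i j; rewrite !mxE.
by rewrite mul0mx !addr0 subrr.
Qed.

(** The equations asking that [d'] cancel the residuals of [z] to first order form
a recursion with nonexpansive steps, because [dsigma] is nonexpansive in the
direction. *)
Lemma linear_correction (rho : R) z d : enorm (z_theta z) <= rho ->
  exists d', [/\ z_theta d' = z_theta d,
    forall t, [/\ lin_w x z d' t = - res_w x z t,
      lin_s alpha z d' t = - res_s alpha z t,
      lin_v z d' t = - res_v z t & lin_r alpha z d' t = - res_r alpha z t] &
    \sum_t enorm (z_r d' t - z_r d t) <=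
    \sum_t (l1norm (lin_v z d t + res_v z t) +
            l1norm (lin_r alpha z d t + res_r alpha z t)) +
    rho * (1 + rho + rho ^+ 2) *
    \sum_t (l1norm (lin_w x z d t + res_w x z t) +
            l1norm (lin_s alpha z d t + res_s alpha z t))].
Proof.
move=> zr.
have [||d' [dth dE dr _]] := @perturbed_recursion R N0 N1 N2 rho (z_V z) (z_W z)
  (fun t => z_W d *m z_sprev z t + z_A d *m x t + z_b d - res_w x z t)
  (fun t => z_V d *m z_s z t + z_c d - res_v z t)
  (fun t u => dsigma alpha (z_w z t) u - res_s alpha z t)
  (fun t u => dsigma alpha (z_v z t) u - res_r alpha z t)
  d (le_trans (enorm_V_le_theta z) zr) (le_trans (enorm_W_le_theta z) zr).
- move=> t u v; rewrite [X in enorm X](_ : _ =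
    dsigma alpha (z_w z t) u - dsigma alpha (z_w z t) v).
    exact: dsigma_nonexpansive.
  by apply/matrixP => i j; rewrite !mxE; ring.
- move=> t u v; rewrite [X in enorm X](_ : _ =
    dsigma alpha (z_v z t) u - dsigma alpha (z_v z t) v).
    exact: dsigma_nonexpansive.
  by apply/matrixP => i j; rewrite !mxE; ring.
exists d'; split=> //.
  have [AE VE WE bE cE] := eq_theta_blocks dth.
  move=> t; have [h1 h2 h3 h4] := dE t.
  rewrite /lin_w /lin_s /lin_v /lin_r AE VE WE bE cE {1}h1 {1}h2 {1}h3 {1}h4.
  by split; apply/matrixP => i j; rewrite !mxE; ring.
apply: (le_trans dr); rewrite le_eqVlt; apply/orP; left; apply/eqP.
congr (_ + _ * _).
  apply: eq_bigr => t _; congr (_ + _); congr l1norm.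
    by rewrite /lin_v; apply/matrixP => i j; rewrite !mxE; ring.
  by rewrite opprB addrA addrAC.
apply: eq_bigr => t _; congr (_ + _); congr l1norm.
  by rewrite /lin_w; apply/matrixP => i j; rewrite !mxE; ring.
by rewrite opprB addrA addrAC.
Qed.

Lemma gamma_ge0 : 0 <= gamma.
Proof. by rewrite divr_ge0 // sqr_ge0. Qed.

(** The bound on the gradient of the data term, times the amplification of the
hidden residuals, is the threshold on [beta1]. *)
Lemma threshold_beta1 : let rho := Num.sqrt (gamma / lambda) in
  Num.sqrt (2 * gamma / 3) * (rho * (1 + rho + rho ^+ 2)) =
  gamma_1 lambda y * gamma * Num.sqrt (2 / (3 * lambda)).
Proof.
move=> rho; have g0 := gamma_ge0.
have -> : gamma_1 lambda y = 1 + rho + rho ^+ 2.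
  by rewrite /gamma_1 !big_ord_recr big_ord0 /= add0r expr0 expr1.
rewrite mulrA mulrC -[RHS]mulrA; congr (_ * _).
rewrite /rho -sqrtrM ?divr_ge0 ?mulr_ge0 //.
rewrite -[X in _ = X * _]ger0_norm // -sqrtr_sqr -sqrtrM ?sqr_ge0 //.
by congr Num.sqrt; field; rewrite gt_eqF.
Qed.

(** With equal parameters only the data term changes; its gradient [(r - y) / 3]
has norm at most [sqrt (6 * gamma) / 3 = sqrt (2 * gamma / 3)]. *)
Lemma dF_theta0 z d d' : enorm (z_rvec z - yvec y) <= Num.sqrt (6 * gamma) ->
  z_theta d' = z_theta d -> dF lambda y z d' <= dF lambda y z d +
    Num.sqrt (2 * gamma / 3) * \sum_t enorm (z_r d' t - z_r d t).
Proof.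
move=> zr dth; have g0 := gamma_ge0.
pose e := d' + (-1) *: d.
have -> : \sum_t enorm (z_r d' t - z_r d t) = \sum_t enorm (z_r e t).
  by apply: eq_bigr => t _; rewrite /e z_linE scaleN1r.
have -> : dF lambda y z d' = dF lambda y z d +
    mxdot (z_rvec z - yvec y) (z_rvec e) / 3.
  by rewrite /dF /e dth z_linE !(mxdotDr, mxdotZr); field.
rewrite lerD2l.
have -> : Num.sqrt (2 * gamma / 3) = Num.sqrt (6 * gamma) / 3.
  have -> : 2 * gamma / 3 = (6 * gamma) * (3^-1) ^+ 2 by field.
  by rewrite sqrtrM ?mulr_ge0 // sqrtr_sqr ger0_norm ?invr_ge0.
rewrite [leRHS]mulrAC ler_pM2r ?invr_gt0 // (le_trans (mxdot_le _ _)) //.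
apply: ler_pM => //; set S := \sum_t _.
have S0 : 0 <= S by apply: sumr_ge0 => t _; exact: enorm_ge0.
rewrite -(@ler_pXn2r _ 2) ?nnegrE // sqr_enorm_rvec expr2 {1}/S mulr_suml.
apply: ler_sum => t _; rewrite expr2 ler_wpM2l //.
by apply: (le_term_sum (f := fun t => enorm (z_r e t))) => i; exact: enorm_ge0.
Qed.

Variables beta1 beta2 : R.
Hypothesis hbeta1 :
  gamma_1 lambda y * gamma * Num.sqrt (2 / (3 * lambda)) < beta1.
Hypothesis hbeta2 : Num.sqrt (2 * gamma / 3) < beta2.
Hypotheses (beta1_gt0 : 0 < beta1) (beta2_gt0 : 0 < beta2).

(** The numerical factors are exactly the thresholds of the penalty weights. *)
Lemma dF_correction z d : Theta beta1 beta2 z <= gamma ->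
  exists d', [/\ 
    forall t, [/\ lin_w x z d' t = - res_w x z t,
      lin_s alpha z d' t = - res_s alpha z t,
      lin_v z d' t = - res_v z t & lin_r alpha z d' t = - res_r alpha z t] &
    dF lambda y z d' <= dF lambda y z d +
    Num.sqrt (2 * gamma / 3) *
    \sum_t (l1norm (lin_v z d t + res_v z t) +
            l1norm (lin_r alpha z d t + res_r alpha z t)) +
    gamma_1 lambda y * gamma * Num.sqrt (2 / (3 * lambda)) *
    \sum_t (l1norm (lin_w x z d t + res_w x z t) +
            l1norm (lin_s alpha z d t + res_s alpha z t))].
Proof.
move=> zg.
have [zth zr _ _] := sublevel_theta hlambda beta1_gt0 beta2_gt0 zg.
have [d' [dth dl dr]] := linear_correction d zth.
exists d'; split=> //; apply: (le_trans (dF_theta0 zr dth)).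
rewrite -[leRHS]addrA lerD2l.
by rewrite -threshold_beta1 -[X in _ + X]mulrA -mulrDr ler_wpM2l // sqrtr_ge0.
Qed.

(** Along the direction that corrects the zero direction all residuals decrease
at unit relative rate; above the thresholds this outweighs the increase of the
data term, unless the residuals already vanish. *)
Lemma stationary_feasible z : Theta beta1 beta2 z <= gamma ->
  d_stationary_free (Theta beta1 beta2) z -> F0 z.
Proof.
move=> zg /(d_stationary_free_Theta _ _ _ halpha) st.
have [d' [dl dr]] := dF_correction 0 zg.
have p1 := pen1_ge0 alpha x z; have p2 := pen2_ge0 alpha z.
have d1 : dpen1 alpha x z d' = - pen1 alpha x z.
  rewrite /pen1 -sumrN; apply: eq_bigr => t _; have [-> -> _ _] := dl t.
  by rewrite !dl1normN opprD.
have d2 : dpen2 alpha z d' = - pen2 alpha z.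
  rewrite /pen2 -sumrN; apply: eq_bigr => t _; have [_ _ -> ->] := dl t.
  by rewrite !dl1normN opprD.
have := st d'; rewrite /dTheta d1 d2 => {}st.
move: dr; have -> : dF lambda y z 0 = 0.
  by have := dF_linear lambda y z 1 0 0; rewrite scale1r addr0 mul1r; lra.
set E2 := (X in Num.sqrt _ * X); set E1 := (X in _ + _ * X).
have -> : E2 = pen2 alpha z.
  by apply: eq_bigr => t _; have [_ _ -> ->] := lin_zero_direction z t; rewrite !add0r.
have -> : E1 = pen1 alpha x z.
  by apply: eq_bigr => t _; have [-> -> _ _] := lin_zero_direction z t; rewrite !add0r.
move=> dr; apply/F0RNN_pen.
have h1 : 0 <= (beta1 - gamma_1 lambda y * gamma * Num.sqrt (2 / (3 * lambda))) *
  pen1 alpha x z by rewrite mulr_ge0 // subr_ge0 ltW.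
have h2 : 0 <= (beta2 - Num.sqrt (2 * gamma / 3)) * pen2 alpha z.
  by rewrite mulr_ge0 // subr_ge0 ltW.
split; apply/eqP.
  have : (beta1 - gamma_1 lambda y * gamma * Num.sqrt (2 / (3 * lambda))) *
    pen1 alpha x z == 0 by apply/eqP; lra.
  by rewrite mulf_eq0 subr_eq0 gt_eqF.
have : (beta2 - Num.sqrt (2 * gamma / 3)) * pen2 alpha z == 0.
  by apply/eqP; lra.
by rewrite mulf_eq0 subr_eq0 gt_eqF.
Qed.

Lemma dTheta_feasible z d : F0 z -> dTheta lambda alpha x y beta1 beta2 z d =
  dF lambda y z d +
  beta1 * (\sum_t (l1norm (lin_w x z d t) + l1norm (lin_s alpha z d t))) +
  beta2 * (\sum_t (l1norm (lin_v z d t) + l1norm (lin_r alpha z d t))).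
Proof.
move=> /F0RNN_res z0; congr (_ + _ * _ + _ * _); apply: eq_bigr => t _;
  by have [h1 h2 h3 h4] := z0 t; rewrite ?(h1, h2, h3, h4) !dl1norm0.
Qed.

(** Replacing a direction by its tangent correction changes the derivative of [F]
by less than the penalties charge for leaving the tangent cone; on the tangent
cone itself the penalties have derivative zero. *)
Lemma stationary_equiv z : Theta beta1 beta2 z <= gamma ->
  d_stationary F0 F z <-> d_stationary_free (Theta beta1 beta2) z.
Proof.
move=> zg; split=> [/d_stationary_F0[Fz zst]|st].
  apply/d_stationary_free_Theta => // d; rewrite dTheta_feasible //.
  have res0 := (F0RNN_res _ _ _).1 Fz.
  have [d' [dl dr]] := dF_correction d zg.
  have d'T : tangent_cone F0 z d'.
    rewrite tangent_coneE //; apply/(tangent_formula_lin x halpha) => t.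
    by have [-> -> -> ->] := dl t; have [-> -> -> ->] := res0 t; rewrite !oppr0.
  move: dr; set E2 := (X in Num.sqrt _ * X); set E1 := (X in _ + _ * X).
  have <- : E2 = \sum_t (l1norm (lin_v z d t) + l1norm (lin_r alpha z d t)).
    by apply: eq_bigr => t _; have [_ _ -> ->] := res0 t; rewrite !addr0.
  have <- : E1 = \sum_t (l1norm (lin_w x z d t) + l1norm (lin_s alpha z d t)).
    by apply: eq_bigr => t _; have [-> -> _ _] := res0 t; rewrite !addr0.
  have E10 : 0 <= E1 by apply: sumr_ge0 => t _; rewrite addr_ge0 ?l1norm_ge0.
  have E20 : 0 <= E2 by apply: sumr_ge0 => t _; rewrite addr_ge0 ?l1norm_ge0.
  have := ler_wpM2r E10 (ltW hbeta1); have := ler_wpM2r E20 (ltW hbeta2).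
  have := zst _ d'T; lra.
have Fz := stationary_feasible zg st.
apply/d_stationary_F0; split=> // d; rewrite tangent_coneE //.
move=> /(tangent_formula_lin x halpha) l0.
have := (d_stationary_free_Theta _ _ _ halpha _ _ _).1 st d.
rewrite dTheta_feasible // big1 ?big1 ?mulr0 ?addr0 // => t _;
  by have [h1 h2 h3 h4] := l0 t; rewrite ?(h1, h2, h3, h4) !l1norm0 addr0.
Qed.

(** A global minimizer has a value at most [Theta 0 = gamma] and is stationary. *)
Lemma S1_subset_F0 z : S1RNN lambda alpha x y beta1 beta2 z -> F0 z.
Proof.
move=> [_ zmin]; apply: stationary_feasible.
  by rewrite -(@Theta0 R N0 N1 N2 lambda alpha x y beta1 beta2); exact: zmin.
have zl : local_minimizer setT (Theta beta1 beta2) z.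
  by split=> //; near=> z' => _; exact: zmin.
by have [] := local_min_second_order_P1 halpha zl.
Unshelve. all: by end_near. Qed.

Lemma S0_eq_S1 : (S0RNN lambda alpha x y : set point) =
  S1RNN lambda alpha x y beta1 beta2.
Proof.
apply/seteqP; split=> z zS.
  have [[zs zsS] _] := @S1_nonempty_compact R N0 N1 N2 _ _ x y hlambda halpha _ _
    beta1_gt0 beta2_gt0.
  split=> // z' _; apply: (le_trans _ (zsS.2 z' I)).
  have zsF := S1_subset_F0 zsS.
  rewrite (Theta_F0 lambda y beta1 beta2 zS.1) (Theta_F0 lambda y beta1 beta2 zsF).
  exact: zS.2.
have Fz := S1_subset_F0 zS; split=> // z' Fz'.
by rewrite -(Theta_F0 lambda y beta1 beta2 Fz) -(Theta_F0 lambda y beta1 beta2 Fz'); exact: zS.2.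
Qed.

End ExactPenalty.

Theorem corollary4p1 (R : realType) (N0 N1 N2 : nat)
    (hN0 : (0 < N0)%N) (hN1 : (0 < N1)%N) (hN2 : (0 < N2)%N)
    (lambda alpha : R) (hlambda : 0 < lambda) (halpha : 0 <= alpha < 1)
    (x : 'I_3 -> 'cV[R]_N0) (y : 'I_3 -> 'cV[R]_N2) :
  let F := F lambda y : 'rV[R]_(nz N0 N1 N2) -> R in
  let F0 := F0RNN alpha x : set 'rV[R]_(nz N0 N1 N2) in
  let Theta := Theta lambda alpha x y in
  let S0 := S0RNN lambda alpha x y : set 'rV[R]_(nz N0 N1 N2) in
  let S1 := S1RNN lambda alpha x y in
  let gamma_y := gamma_y y in
  let gamma_1 := gamma_1 lambda y in
  [/\ (* (i) *)
      (forall beta1 beta2 : R, 0 < beta1 -> 0 < beta2 ->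
         [/\ S0 !=set0, compact S0,
             S1 beta1 beta2 !=set0 & compact (S1 beta1 beta2)]),
      (* (ii) *)
      [/\ forall z : 'rV[R]_(nz N0 N1 N2),
            local_minimizer F0 F z -> second_order_d_stationary F0 F z,
          forall beta1 beta2 : R, 0 < beta1 -> 0 < beta2 ->
            forall z : 'rV[R]_(nz N0 N1 N2),
              local_minimizer setT (Theta beta1 beta2) z ->
              second_order_d_stationary_free (Theta beta1 beta2) z,
          forall z, F0 z -> tangent_cone F0 z = tangent_formula alpha x z
        & forall z, F0 z ->
            radial_cone F0 z =
              [set d | tangent_cone F0 z d /\
                 forall t : 'I_3, z_V d *m z_s d t = 0 /\
                                  z_W d *m z_sprev d t = 0]]
    & (* (iii) *)
      forall beta1 beta2 : R, 0 < beta1 -> 0 < beta2 ->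
        Theta beta1 beta2 0 = gamma_y /\
        (beta1 > gamma_1 * gamma_y * Num.sqrt (2 / (3 * lambda)) ->
         beta2 > Num.sqrt (2 * gamma_y / 3) ->
         S0 = S1 beta1 beta2 /\
         forall z, Theta beta1 beta2 z <= gamma_y ->
           (d_stationary F0 F z <-> d_stationary_free (Theta beta1 beta2) z))].
Proof.
move=> F F0 Theta S0 S1 gamma gamma1; split.
- move=> b1 b2 b1_gt0 b2_gt0.
  have [ne0 co0] := @S0_nonempty_compact R N0 N1 N2 _ _ x y hlambda halpha.
  have [ne1 co1] :=
    @S1_nonempty_compact R N0 N1 N2 _ _ x y hlambda halpha _ _ b1_gt0 b2_gt0.
  by split.
- split.
  + exact: local_min_second_order_P0.
  + by move=> b1 b2 _ _ z; exact: local_min_second_order_P1.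
  + exact: tangent_coneE.
  + exact: radial_coneE.
- move=> b1 b2 b1_gt0 b2_gt0; split; first exact: Theta0.
  move=> b1_large b2_large; split; first exact: S0_eq_S1.
  by move=> z zg; exact: stationary_equiv.
Qed.
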